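(* Every nonabelian nilpotent real Lie algebra of dimension at most $7$ that admits a nice basis and is not isomorphic to $(0,0,e^{12})$ or to $(0,0,0,e^{12})$ has a Ricci-flat metric that is not flat.
   Context: A basis $\{e_1,\dots,e_n\}$ of a Lie algebra $\mathfrak{g}$, with dual basis $\{e^1,\dots,e^n\}$, is nice if each $[e_i,e_j]$ is a multiple of a single basis element $e_k$ depending on $i,j$, and each interior product $e_i\lrcorner de^j$ (where $d$ is the Chevalley--Eilenberg differential, $de^j(x,y)=-e^j([x,y])$) is a multiple of a single $e^h$ depending on $i,j$. The notation $(0,0,e^{12})$ denotes the $3$-dimensional Lie algebra having a basis with $de^1=de^2=0$, $de^3=e^{1}\wedge e^{2}$ (the Heisenberg Lie algebra); $(0,0,0,e^{12})$ denotes the $4$-dimensional Lie algebra having a basis with $de^1=de^2=de^3=0$, $de^4=e^1\wedge e^2$. A metric on $\mathfrak{g}$ is a nondegenerate symmetric bilinear form (of any signature), identified with the left-invariant pseudo-Riemannian metric it defines on a Lie group with Lie algebra $\mathfrak{g}$; Ricci-flat (resp. flat) means that the Ricci tensor (resp. the full curvature tensor) of its Levi-Civita connection vanishes. *)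

(* Defs.v *)
From HB Require Import structures.
From mathcomp Require Import all_boot all_order all_algebra.
From mathcomp Require Import ring reals.

Set Implicit Arguments.
Unset Strict Implicit.
Unset Printing Implicit Defensive.

Import GRing.Theory.
Local Open Scope ring_scope.

HB.mixin Record Vector_isLieAlgebra (F : fieldType) V of Vector F V := {
  lie_bracket : V -> V -> V;
  lie_bracket_is_bilinear :
    bilinear_for (GRing.Scale.Law.clone _ _ *:%R _)
      (GRing.Scale.Law.clone _ _ *:%R _) lie_bracket;
  lie_bracketxx : forall x, lie_bracket x x = 0;
  lie_jacobi : forall x y z,
    lie_bracket x (lie_bracket y z) + lie_bracket y (lie_bracket z x)
      + lie_bracket z (lie_bracket x y) = 0
}.

#[short(type="lieAlgType")]
HB.structure Definition LieAlgebra (F : fieldType) :=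
  { V of Vector F V & Vector_isLieAlgebra F V }.

Notation "[lie x , y ]" := (lie_bracket x y)
  (at level 0, format "[lie  x ,  y ]") : ring_scope.

HB.instance Definition _ (F : fieldType) (V : lieAlgType F) :=
  bilinear_isBilinear.Build F V V V _ _ (@lie_bracket F V)
    (@lie_bracket_is_bilinear F V).

Section LieAlgebras.
Variables (F : fieldType) (V : lieAlgType F).
Implicit Types (x y z : V) (A B : {vspace V}).

Lemma lie_bracketC x y : [lie x, y] = - [lie y, x].
Proof.
apply/eqP; rewrite -addr_eq0; apply/eqP.
have := lie_bracketxx (x + y).
by rewrite linearDl !linearDr /= !lie_bracketxx add0r addr0 addrC.
Qed.

Definition lie_abelian := forall x y, [lie x, y] = 0.

(* [A, B], the span of all brackets of elements of A and B; by bilinearity it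
   is spanned by the brackets of basis vectors. *)
Definition lie_prodv A B : {vspace V} :=
  <<[seq [lie x, y] | x <- vbasis A, y <- vbasis B]>>%VS.

Lemma memv_lie_prodv A B x y :
  x \in A -> y \in B -> [lie x, y] \in lie_prodv A B.
Proof.
move=> Ax By; rewrite (coord_vbasis Ax) (coord_vbasis By) linear_sumlz.
apply: memv_suml => i _; rewrite linear_sumr; apply: memv_suml => j _.
rewrite linearZl_LR linearZr_LR /= !memvZ // memv_span //.
by apply/allpairsP; exists ((vbasis A)`_i, (vbasis B)`_j); split=> //=;
  apply: mem_nth; rewrite size_tuple.
Qed.

Lemma lie_prodv_subv A B (C : {vspace V}) :
  (forall x y, x \in A -> y \in B -> [lie x, y] \in C) ->
  (lie_prodv A B <= C)%VS.
Proof.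
move=> ABC; apply/span_subvP=> _ /allpairsP[[x y] /= [Ax By ->]].
by apply: ABC; apply: vbasis_mem.
Qed.

Definition lower_central (k : nat) : {vspace V} := iter k (lie_prodv {:V}) {:V}%VS.

Definition lie_nilpotent := exists k, lower_central k = 0%VS.

Definition ce_diff (a : V -> F) : V -> V -> F := fun x y => - a [lie x, y].

Definition interior x (w : V -> V -> F) : V -> F := fun y => w x y.

(* When e is a basis, coord e is its dual basis. *)
Definition nice_basis n (e : n.-tuple V) :=
  [/\ basis_of {:V} e,
      forall i j : 'I_n, exists (k : 'I_n) (c : F), [lie e`_i, e`_j] = c *: e`_k
    & forall i j : 'I_n, exists (h : 'I_n) (c : F), forall y,
        interior e`_i (ce_diff (coord e j)) y = c * coord e h y].

Definition admits_nice_basis := exists e : (\dim {:V}).-tuple V, nice_basis e.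

End LieAlgebras.

Definition lie_isomorphic (F : fieldType) (V W : lieAlgType F) :=
  exists f : {linear V -> W},
    bijective f /\ forall x y, f [lie x, y] = [lie f x, f y].

(* heisenberg F m is the Lie algebra (0, ..., 0, e^{12}) of dimension m + 3, in
   the standard basis of row vectors: see ce_diff_heisenberg below. *)
Definition heisenberg (F : fieldType) (m : nat) : Type := 'rV[F]_m.+3.

HB.instance Definition _ (F : fieldType) m :=
  Vector.copy (heisenberg F m) 'rV[F]_m.+3.

Section Heisenberg.
Variables (F : fieldType) (m : nat).
Local Notation H := (heisenberg F m).

Definition heisenberg_bracket (x y : H) : H :=
  - (x 0 0 * y 0 1 - x 0 1 * y 0 0) *: delta_mx 0 ord_max.

Fact heisenberg_bilinear :
  bilinear_for (GRing.Scale.Law.clone _ _ *:%R _)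
    (GRing.Scale.Law.clone _ _ *:%R _) heisenberg_bracket.
Proof.
split=> [y|x] c u v; rewrite /heisenberg_bracket /= scalerA -scalerDl !mxE;
  congr (_ *: _); ring.
Qed.

Fact heisenberg_bracketxx x : heisenberg_bracket x x = 0.
Proof. by rewrite /heisenberg_bracket mulrC subrr oppr0 scale0r. Qed.

Fact heisenberg_jacobi x y z :
  heisenberg_bracket x (heisenberg_bracket y z)
    + heisenberg_bracket y (heisenberg_bracket z x)
    + heisenberg_bracket z (heisenberg_bracket x y) = 0.
Proof.
have cent u v w : heisenberg_bracket u (heisenberg_bracket v w) = 0.
  by rewrite /heisenberg_bracket !mxE !(mulr0, subrr, oppr0) scale0r.
by rewrite !cent !addr0.
Qed.

HB.instance Definition _ := Vector_isLieAlgebra.Build F H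
  heisenberg_bilinear heisenberg_bracketxx heisenberg_jacobi.

Lemma ce_diff_heisenberg (k : 'I_m.+3) (x y : H) :
  ce_diff (fun z : H => z 0 k) x y
    = if k == ord_max then x 0 0 * y 0 1 - x 0 1 * y 0 0 else 0.
Proof.
rewrite /ce_diff /lie_bracket /= /heisenberg_bracket !mxE eqxx /=.
by case: eqP; rewrite ?mulr1 ?mulr0 ?opprK ?oppr0.
Qed.

End Heisenberg.

Section Metrics.
Variables (F : fieldType) (V : lieAlgType F).
Implicit Types (g : {symmetric V}) (nabla : {bilinear V -> V -> V}).

(* The Levi-Civita connection of a left-invariant metric, as a bilinear product
   on left-invariant vector fields: nabla x y is the derivative of y along x. *)
Definition levi_civita g nabla :=
  (forall x y, nabla x y - nabla y x = [lie x, y]) /\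
  (forall x y z, g (nabla x y) z + g y (nabla x z) = 0).

Definition curvature nabla (x y z : V) : V :=
  nabla x (nabla y z) - nabla y (nabla x z) - nabla [lie x, y] z.

Definition endo_trace (f : V -> V) : F :=
  \sum_(i < \dim {:V}) coord (vbasis {:V}) i (f (vbasis {:V})`_i).

Definition ricci nabla (y z : V) : F :=
  endo_trace (fun x => curvature nabla x y z).

(* Existence and uniqueness of the connection quantified over here are
   levi_civita_exists and levi_civita_uniq below. *)
Definition ricci_flat g :=
  exists nabla, levi_civita g nabla /\ forall y z, ricci nabla y z = 0.

Definition flat g :=
  exists nabla, levi_civita g nabla /\ forall x y z, curvature nabla x y z = 0.

Lemma endo_trace_basis n (e : n.-tuple V) (f : {linear V -> V}) :
  basis_of {:V} e -> endo_trace f = \sum_(i < n) coord e i (f e`_i).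
Proof.
move=> eB; rewrite /endo_trace; set b := vbasis _.
have bB : basis_of {:V} b by apply: vbasisP.
transitivity (\sum_(i < \dim {:V}) \sum_(j < n)
    coord b i (f e`_j) * coord e j b`_i).
  apply: eq_bigr => i _; rewrite {1}(coord_basis eB (memvf b`_i)).
  by rewrite !linear_sum; apply: eq_bigr => j _; rewrite !linearZ /= mulrC.
rewrite exchange_big; apply: eq_bigr => j _ /=.
rewrite [in RHS](coord_basis bB (memvf (f e`_j))) linear_sum.
by apply: eq_bigr => i _; rewrite linearZ.
Qed.

Lemma form_sym g x y : g x y = g y x.
Proof. by rewrite hermC expr0 mul1r. Qed.

Lemma form_nondegP g :
  nondegenerate g <-> forall x, (forall y, g x y = 0) -> x = 0.
Proof.
rewrite /nondegenerate -subv0; split=> [/subvP g0 x gx | gx].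
  by apply/eqP; rewrite -memv0; apply: g0; apply/mem_orthovP => y _; apply: gx.
apply/subvP=> x /mem_orthovP x0; rewrite memv0; apply/eqP/gx => y.
by apply: x0; rewrite memvf.
Qed.

Lemma levi_civita_koszul g nabla x y z : levi_civita g nabla ->
  g (nabla x y) z *+ 2 = g [lie x, y] z - g [lie y, z] x + g [lie z, x] y.
Proof.
case=> tor met; rewrite -!tor !linearBl /=.
have opp u v w : g (nabla u v) w = - g (nabla u w) v.
  by apply/eqP; rewrite -addr_eq0 [X in _ + X]form_sym; apply/eqP/met.
rewrite (opp z y) (opp y z) (opp x z); ring.
Qed.

Lemma levi_civita_uniq g nabla nabla' : (2%:R : F) != 0 -> nondegenerate g ->
  levi_civita g nabla -> levi_civita g nabla' -> nabla =2 nabla'.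
Proof.
move=> two /form_nondegP g0 L L' x y; apply/eqP; rewrite -subr_eq0; apply/eqP.
apply: g0 => z; rewrite linearBl /=; apply/eqP.
have : (g (nabla x y) z - g (nabla' x y) z) *+ 2 == 0.
  by rewrite mulrnBl !(levi_civita_koszul _ _ _ L, levi_civita_koszul _ _ _ L') subrr.
by rewrite -mulr_natr mulf_eq0 (negPf two) orbF.
Qed.

Lemma levi_civita_exists g : (2%:R : F) != 0 -> nondegenerate g ->
  exists nabla, levi_civita g nabla.
Proof.
move=> two /form_nondegP g0; pose b := vbasis {:V}.
have bB : basis_of {:V} b := vbasisP _.
have gDl u v w : g (u + v) w = g u w + g v w by rewrite linearDl.
have gDr u v w : g w (u + v) = g w u + g w v by rewrite linearDr.
have gZl c v w : g (c *: v) w = c * g v w by rewrite linearZl_LR.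
have gZr c v w : g w (c *: v) = c * g w v by rewrite linearZr_LR.
pose sharp (a : V -> F) : V := \sum_(i < \dim {:V}) a b`_i *: b`_i.
have phi_lin : linear (fun v => sharp (g v)).
  move=> c u v; rewrite /sharp scaler_sumr -big_split /=.
  by apply: eq_bigr => i _; rewrite gDl gZl scalerDl scalerA.
pose phim := GRing.isLinear.Build F V V *:%R _ phi_lin.
pose phil : {linear V -> V} := HB.pack (fun v => sharp (g v)) phim.
pose phi : 'End(V) := linfun phil.
have phiE v : phi v = sharp (g v) by rewrite lfunE.
have sharp_inj (a a' : V -> F) : sharp a = sharp a' ->
    forall i : 'I_(\dim {:V}), a b`_i = a' b`_i.
  move=> E i; have := congr1 (coord b i) E.
  by rewrite !coord_sum_free ?(basis_free bB).
have gext v (a : {scalar V}) : sharp (g v) = sharp a -> g v =1 a.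
  move=> E z; rewrite (coord_basis bB (memvf z)) !linear_sum /=.
  by apply: eq_bigr => i _; rewrite gZr linearZ /= (sharp_inj _ _ E).
have kerphi : lker phi == 0%VS.
  rewrite -subv0; apply/subvP => v; rewrite memv_ker phiE memv0 => /eqP v0.
  apply/eqP/g0 => z; rewrite (gext v (GRing.null_fun F)) //.
  by rewrite v0 /sharp big1 // => i _; rewrite scale0r.
pose K x y z := (g [lie x, y] z - g [lie y, z] x + g [lie z, x] y) / 2%:R.
have KDx c x x' y z : K (c *: x + x') y z = c * K x y z + K x' y z.
  rewrite /K linearDl !linearDr !linearZl_LR !linearZr_LR /=.
  by rewrite !(gDl, gDr, gZl, gZr); ring.
have KDy c x y y' z : K x (c *: y + y') z = c * K x y z + K x y' z.
  rewrite /K linearDl !linearDr !linearZl_LR !linearZr_LR /=.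
  by rewrite !(gDl, gDr, gZl, gZr); ring.
have KDz x y : scalar (K x y).
  move=> c z z'; rewrite /K linearDl !linearDr !linearZl_LR !linearZr_LR /=.
  by rewrite !(gDl, gDr, gZl, gZr); ring.
pose nab x y := (phi^-1)%VF (sharp (K x y)).
have nabE x y z : g (nab x y) z = K x y z.
  pose Km := GRing.isLinear.Build F V F *%R _ (KDz x y).
  pose Kl : {scalar V} := HB.pack (K x y) Km.
  by apply: (gext _ Kl); rewrite -phiE lker0_lfunVK.
have nab_bil : bilinear_for (GRing.Scale.Law.clone _ _ *:%R _)
    (GRing.Scale.Law.clone _ _ *:%R _) nab.
  by split=> [y|x] c u v /=; apply/eqP; rewrite -subr_eq0; apply/eqP/g0 => z;
     rewrite -scaleN1r !(gDl, gZl) !nabE ?KDx ?KDy; ring.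
pose nabm := bilinear_isBilinear.Build F V V V _ _ nab nab_bil.
pose nabl : {bilinear V -> V -> V} := HB.pack nab nabm.
exists nabl; split=> [x y | x y z] /=.
  apply/eqP; rewrite -subr_eq0; apply/eqP/g0 => z.
  rewrite -!scaleN1r !(gDl, gZl) !nabE /K (lie_bracketC y x) (lie_bracketC x z).
  by rewrite (lie_bracketC z y) -!scaleN1r !gZl; field; exact: two.
rewrite [g y _]form_sym !nabE /K (lie_bracketC z y) (lie_bracketC y x).
rewrite (lie_bracketC x z) -!scaleN1r !gZl; field; exact: two.
Qed.

End Metrics.

(* Main.v *)
From HB Require Import structures.
Require Import Defs.
From mathcomp Require Import all_boot all_order all_algebra.
From mathcomp Require Import ring reals perm.

(** Sort a nice basis by depth in the lower central series: every arrow
    [e_i, e_j] = c e_k with c <> 0 then has i, j < k, and k is determined by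
    i, j while j is determined by i, k. Consider the metrics that pair e_i with
    e_(s i) for an involution s of the indices. Since the algebra is unimodular,
    ric(y, z) = - tr ((x |-> nabla_x y) o (x |-> nabla_x z)), a sum of products of
    two structure constants; when s is arrow-breaking (s never sends the two
    sources of an arrow to the two sources of an arrow, nor a source and the
    target of an arrow to a source and the target of an arrow), these products
    vanish or cancel in pairs, so that the metric is Ricci-flat whatever its
    coefficients. In dimension at most 7 the sets of arrows compatible with the
    Jacobi identity (a nonzero double bracket is never alone in its component)
    can be enumerated. Almost all of them have an arrow-breaking s; for the
    others, the coefficients of the metric are chosen as monomials in the
    structure constants in such a way that ric = 0. The metric is not flat as soon
    as a curvature coefficient is a single Laurent monomial in the structure
    constants and in the metric coefficients; if only its part even (or odd) in
    one metric coefficient is a monomial, then it is nonzero for that coefficient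
    or for its opposite. The search fails precisely for the abelian algebras and
    for the Heisenberg algebras of dimension 3 and 4. *)

Set Implicit Arguments.
Unset Strict Implicit.
Unset Printing Implicit Defensive.

Import GRing.Theory Num.Theory.

(** * Coordinates and metrics adapted to an involution *)

Local Open Scope ring_scope.

Section Coordinates.
Variables (F : fieldType) (V : lieAlgType F) (n : nat) (e : n.-tuple V).

(** Indices are natural numbers, with value 0 out of range, so that structure constants accept
    computed indices such as [s k]. *)
Definition coordn (k : nat) (v : V) : F :=
  if insub k is Some m then coord e m v else 0.

Definition sconst (i j k : nat) : F := coordn k [lie e`_i, e`_j].

Lemma coordn_ord (k : 'I_n) v : coordn k v = coord e k v.
Proof. by rewrite /coordn valK. Qed.

Lemma coordn_out k v : (n <= k)%N -> coordn k v = 0.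
Proof. by move=> nk; rewrite /coordn insubF // ltnNge nk. Qed.

Lemma coordnD k u v : coordn k (u + v) = coordn k u + coordn k v.
Proof. by rewrite /coordn; case: insub => [m|]; rewrite ?linearD ?addr0. Qed.

Lemma coordnZ k a v : coordn k (a *: v) = a * coordn k v.
Proof. by rewrite /coordn; case: insub => [m|]; rewrite ?linearZ ?mulr0. Qed.

Lemma coordnB k u v : coordn k (u - v) = coordn k u - coordn k v.
Proof. by rewrite -scaleN1r coordnD coordnZ mulN1r. Qed.

Lemma coordn0 k : coordn k 0 = 0.
Proof. by rewrite -(scale0r 0) coordnZ mul0r. Qed.

Lemma coordn_sum k (f : nat -> V) m :
  coordn k (\sum_(i < m) f i) = \sum_(i < m) coordn k (f i).
Proof.
by elim: m => [|m IH]; rewrite ?big_ord0 ?coordn0 // !big_ord_recr coordnD IH.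
Qed.

Lemma sconst_antisym i j k : sconst i j k = - sconst j i k.
Proof. by rewrite /sconst lie_bracketC -scaleN1r coordnZ mulN1r. Qed.

Lemma sconstii i k : sconst i i k = 0.
Proof. by rewrite /sconst lie_bracketxx coordn0. Qed.

Lemma sconst_out i j k : [|| n <= i, n <= j | n <= k]%N -> sconst i j k = 0.
Proof.
rewrite /sconst; case/or3P=> le_n; last exact: coordn_out.
  by rewrite nth_default ?size_tuple // linear0l coordn0.
by rewrite [X in [lie _, X]]nth_default ?size_tuple // linear0r coordn0.
Qed.

Hypothesis eB : basis_of {:V} e.

Lemma coordn_basis i k : (i < n)%N -> coordn k e`_i = (k == i)%:R.
Proof.
move=> lt_in; case: (ltnP k n) => [lt_kn | le_nk]; last first.
  by rewrite coordn_out //; case: eqP => // k_i; rewrite k_i leqNgt lt_in in le_nk.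
rewrite (coordn_ord (Ordinal lt_kn)) (coord_free (Ordinal lt_in) _ (basis_free eB)).
by rewrite -(inj_eq val_inj) eq_sym.
Qed.

Lemma coordnE v : v = \sum_(k < n) coordn k v *: e`_k.
Proof.
rewrite {1}(coord_basis eB (memvf v)).
by apply: eq_bigr => k _; rewrite coordn_ord.
Qed.

Lemma coordn_inj u v : (forall k, (k < n)%N -> coordn k u = coordn k v) -> u = v.
Proof. by move=> uv; rewrite (coordnE u) (coordnE v); apply: eq_bigr => k _; rewrite uv. Qed.

Lemma sum_delta k (f : nat -> F) : (k < n)%N ->
  \sum_(i < n) (i == k :> nat)%:R * f i = f k.
Proof.
move=> lt_kn; rewrite (bigD1 (Ordinal lt_kn)) //= eqxx mul1r big1 ?addr0 //.
by move=> i /negPf neq; rewrite -(inj_eq val_inj) /= in neq; rewrite neq mul0r.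
Qed.

Lemma coordn_linear (f : {linear V -> V}) k v :
  coordn k (f v) = \sum_(m < n) coordn m v * coordn k (f e`_m).
Proof.
rewrite {1}(coordnE v) linear_sum (coordn_sum _ (fun m => f (coordn m v *: e`_m))).
by apply: eq_bigr => m _; rewrite linearZ coordnZ.
Qed.

End Coordinates.

Lemma big_invol (M : nmodType) n (s : nat -> nat) (f : nat -> M) :
  (forall i, (i < n)%N -> (s i < n)%N) -> (forall i, (i < n)%N -> s (s i) = i) ->
  \sum_(i < n) f (s i) = \sum_(i < n) f i.
Proof.
move=> s_lt s_invol; pose h (i : 'I_n) := Ordinal (s_lt i (ltn_ord i)).
rewrite [RHS](reindex_inj (h := h)) //.
by apply: (can_inj (g := h)) => i; apply: val_inj; rewrite /= s_invol.
Qed.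

Section SigmaMetric.
Variables (F : numFieldType) (V : lieAlgType F) (n : nat) (e : n.-tuple V).
Hypothesis eB : basis_of {:V} e.
Variables (s : nat -> nat) (g : nat -> F).
Hypothesis s_lt : forall i, (i < n)%N -> (s i < n)%N.
Hypothesis s_invol : forall i, (i < n)%N -> s (s i) = i.
Hypothesis g_neq0 : forall i, (i < n)%N -> g i != 0.
Hypothesis g_inv : forall i, (i < n)%N -> g (s i) = g i.

Local Notation coordn := (coordn e).
Local Notation c := (sconst e).

Definition sform (x y : V) : F := \sum_(i < n) g i * coordn i x * coordn (s i) y.

Lemma sform_sym x y : sform x y = sform y x.
Proof.
rewrite /sform -(big_invol (fun i => g i * coordn i x * coordn (s i) y) s_lt s_invol).
by apply: eq_bigr => i _; rewrite s_invol // g_inv // mulrAC.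
Qed.

Lemma sform_bilinear :
  bilinear_for ( *%R : GRing.Scale.law F F) (idfun \; *%R : GRing.Scale.law F F) sform.
Proof.
have lin x a u v : sform (a *: u + v) x = a * sform u x + sform v x.
  rewrite /sform mulr_sumr -big_split; apply: eq_bigr => i _ /=.
  by rewrite coordnD coordnZ; ring.
split=> [x|x] a u v /=; first exact: lin.
by rewrite ![sform x _]sform_sym lin.
Qed.

Lemma sform_basisr x k : (k < n)%N -> sform x e`_(s k) = g k * coordn k x.
Proof.
move=> lt_kn; rewrite /sform -(sum_delta (fun i => g i * coordn i x) lt_kn).
apply: eq_bigr => i _; rewrite coordn_basis ?s_lt // mulrC; congr (_%:R * _).
congr nat_of_bool; apply/eqP/eqP=> [eq_s|->//].
by rewrite -(s_invol (ltn_ord i)) eq_s s_invol.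
Qed.

Lemma sform_basis x k : (k < n)%N -> sform x e`_k = g k * coordn (s k) x.
Proof.
by move=> lt_kn; rewrite -{1}(s_invol lt_kn) sform_basisr ?s_lt // g_inv.
Qed.

Lemma smetric_exists :
  exists G : {symmetric V}, nondegenerate G /\ forall x y, G x y = sform x y.
Proof.
pose Gb := bilinear_isBilinear.Build F V V F _ _ sform sform_bilinear.
have hs : forall x y, sform x y = (-1) ^+ false * idfun (sform y x).
  by move=> x y; rewrite expr0 mul1r sform_sym.
pose Gh := isHermitianSesquilinear.Build F V false idfun sform hs.
pose G : {symmetric V} := HB.pack sform Gb Gh.
exists G; split=> //; apply/form_nondegP => x /= x0.
apply: (coordn_inj eB) => k lt_kn; rewrite coordn0.
have := x0 e`_(s k); rewrite /= sform_basisr // => /eqP.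
by rewrite mulf_eq0 (negPf (g_neq0 lt_kn)) => /eqP.
Qed.

End SigmaMetric.

(** * The Levi-Civita connection *)

Section RicciLinear.
Variables (F : fieldType) (V : lieAlgType F) (nabla : {bilinear V -> V -> V}).

Lemma nabla_linl a p q r : nabla (a *: p + q) r = a *: nabla p r + nabla q r.
Proof. by rewrite linearPl. Qed.

Lemma nabla_linr a p q r : nabla r (a *: p + q) = a *: nabla r p + nabla r q.
Proof. by rewrite linearP. Qed.

Lemma bracket_linr a (p q r : V) : [lie r, a *: p + q] = a *: [lie r, p] + [lie r, q].
Proof. by rewrite linearDr linearZr_LR. Qed.

Lemma subD3 (p p' q q' r r' : V) :
  p + p' - (q + q') - (r + r') = p - q - r + (p' - q' - r').
Proof. by rewrite (opprD q) addrACA (opprD r) [LHS]addrACA. Qed.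

Lemma curvature_linear y z : linear (fun x => curvature nabla x y z).
Proof.
move=> a u v; rewrite /curvature.
have -> : [lie a *: u + v, y] = a *: [lie u, y] + [lie v, y] by rewrite linearPl.
by rewrite !(nabla_linl, nabla_linr) subD3 !scalerBr.
Qed.

Lemma ricci_linl a u v z :
  ricci nabla (a *: u + v) z = a * ricci nabla u z + ricci nabla v z.
Proof.
rewrite /ricci /endo_trace mulr_sumr -big_split; apply: eq_bigr => i _ /=.
rewrite -linearZ -linearD; congr (coord _ _ _); rewrite /curvature.
by rewrite bracket_linr !(nabla_linl, nabla_linr) subD3 !scalerBr.
Qed.

Lemma ricci_linr a u v y :
  ricci nabla y (a *: u + v) = a * ricci nabla y u + ricci nabla y v.
Proof.
rewrite /ricci /endo_trace mulr_sumr -big_split; apply: eq_bigr => i _ /=.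
rewrite -linearZ -linearD; congr (coord _ _ _); rewrite /curvature.
by rewrite !nabla_linr subD3 !scalerBr.
Qed.

Lemma ricci_basis0 n (e : n.-tuple V) : basis_of {:V} e ->
  (forall y z, (y < n)%N -> (z < n)%N -> ricci nabla e`_y e`_z = 0) ->
  forall y z, ricci nabla y z = 0.
Proof.
move=> eB r0 y z.
have r0l w : ricci nabla 0 w = 0.
  by have := ricci_linl (-1) 0 0 w; rewrite scaler0 addr0 mulN1r addNr.
have r0r w : ricci nabla w 0 = 0.
  by have := ricci_linr (-1) 0 0 w; rewrite scaler0 addr0 mulN1r addNr.
rewrite (coordnE eB y); elim/big_rec: _ => [//|i u _ IHu]; rewrite ricci_linl IHu addr0.
rewrite (coordnE eB z); elim/big_rec: _ => [|j v _ IHv]; first by rewrite r0r mulr0.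
by rewrite ricci_linr mulrDr IHv r0 // !mulr0 addr0.
Qed.

End RicciLinear.

(* Twice the Christoffel symbols of [sform]: the k-th coordinate of
   [x, y] - ad_x^* y - ad_y^* x, the adjoints being taken with respect to [sform]. *)
Definition christoffel (F : fieldType) (c : nat -> nat -> nat -> F)
    (s : nat -> nat) (g : nat -> F) (x y k : nat) : F :=
  c x y k - (c x (s k) (s y) * g y + c y (s k) (s x) * g x) / g k.

Section Curvature.
Variables (F : numFieldType) (V : lieAlgType F) (n : nat) (e : n.-tuple V).
Hypothesis eB : basis_of {:V} e.
Variables (s : nat -> nat) (g : nat -> F).
Hypothesis s_lt : forall i, (i < n)%N -> (s i < n)%N.
Hypothesis s_invol : forall i, (i < n)%N -> s (s i) = i.
Hypothesis g_neq0 : forall i, (i < n)%N -> g i != 0.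
Hypothesis g_inv : forall i, (i < n)%N -> g (s i) = g i.

Local Notation coordn := (coordn e).
Local Notation c := (sconst e).
Local Notation Gam := (christoffel c s g).

Variables (G : {symmetric V}) (nabla : {bilinear V -> V -> V}).
Hypothesis GE : forall x y, G x y = sform e s g x y.
Hypothesis LC : levi_civita G nabla.

(** Koszul's formula with third argument e_(s k), which picks out the k-th coordinate times
    [g k]. *)
Lemma coordn_nabla x y k : (x < n)%N -> (y < n)%N -> (k < n)%N ->
  coordn k (nabla e`_x e`_y) *+ 2 = Gam x y k.
Proof.
move=> xn yn kn; have := levi_civita_koszul e`_x e`_y e`_(s k) LC.
rewrite !GE sform_basisr // sform_basisr // !(sform_basis eB s_lt s_invol g_inv) //.
rewrite -/(c x y k) -/(c y (s k) (s x)) -/(c (s k) x (s y)) -mulrnAr => gk.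
apply: (mulfI (g_neq0 kn)); rewrite gk /christoffel (sconst_antisym e (s k)).
by field; apply: g_neq0.
Qed.

Lemma coordn_nabla_r x v k :
  coordn k (nabla e`_x v) = \sum_(m < n) coordn m v * coordn k (nabla e`_x e`_m).
Proof. exact: (coordn_linear eB (nabla e`_x)). Qed.

Lemma coordn_nabla_l v y k :
  coordn k (nabla v e`_y) = \sum_(m < n) coordn m v * coordn k (nabla e`_m e`_y).
Proof.
rewrite {1}(coordnE eB v) linear_sumlz.
rewrite (coordn_sum e k (fun m => nabla (coordn m v *: e`_m) e`_y)).
by apply: eq_bigr => m _; rewrite linearZl_LR coordnZ.
Qed.

Lemma coordn_curvature x y z w : (x < n)%N -> (y < n)%N -> (z < n)%N -> (w < n)%N ->
  coordn w (curvature nabla e`_x e`_y e`_z) *+ 4 =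
  \sum_(m < n) (Gam y z m * Gam x m w - Gam x z m * Gam y m w
                - c x y m * Gam m z w *+ 2).
Proof.
move=> xn yn zn wn; rewrite /curvature !coordnB coordn_nabla_r (coordn_nabla_r _ (nabla _ _)).
rewrite coordn_nabla_l -!sumrB -sumrMnl; apply: eq_bigr => m _.
by rewrite -!coordn_nabla //; rewrite /sconst; ring.
Qed.

Hypothesis c_sorted : forall i j k, c i j k != 0 -> (i < k)%N /\ (j < k)%N.

(** The connection is torsion-free: the two adjoint terms together are symmetric in the lower
    indices. *)
Lemma christoffel_skew x y m :  Gam y m x - Gam m y x = c y m x *+ 2.
Proof. by rewrite /christoffel (sconst_antisym e m y); ring. Qed.

(** This is twice the divergence of e_m. Sortedness kills the terms [c x m x] and [c m (s x) (s x)];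
    the remaining ones change sign under x |-> s x. *)
Lemma sum_christoffel0 m : (m < n)%N -> \sum_(x < n) Gam x m x = 0.
Proof.
move=> mn.
have c0 i j : c i j i = 0.
  by apply/eqP/negPn/negP => /c_sorted[]; rewrite ltnn.
have c0' i j : c i j j = 0.
  by apply/eqP/negPn/negP => /c_sorted[_]; rewrite ltnn.
have h : \sum_(x < n) c x (s x) (s m) * g m / g x = 0.
  have: (\sum_(x < n) c x (s x) (s m) * g m / g x) *+ 2 = 0.
    rewrite mulr2n -{1}(big_invol (fun x => c x (s x) (s m) * g m / g x) s_lt s_invol).
    rewrite -big_split big1 // => x _ /=.
    by rewrite s_invol // g_inv // (sconst_antisym e (s x)); ring.
  by move/eqP; rewrite mulrn_eq0 => /eqP.
transitivity (- \sum_(x < n) c x (s x) (s m) * g m / g x); last by rewrite h oppr0.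
rewrite -sumrN; apply: eq_bigr => x _.
by rewrite /christoffel c0 c0' mul0r addr0 sub0r.
Qed.

(** In the trace of the curvature the divergence term vanishes. By torsion-freeness the bracket
    terms cancel after an exchange of summation indices, and one product of symbols is left. *)
Lemma ricciE y z : (y < n)%N -> (z < n)%N ->
  ricci nabla e`_y e`_z *+ 4 = - \sum_(i < n) \sum_(k < n) Gam i y k * Gam k z i.
Proof.
move=> yn zn; rewrite /ricci.
pose lm := GRing.isLinear.Build F V V *:%R _ (curvature_linear nabla e`_y e`_z).
pose f : {linear V -> V} := HB.pack (fun x => curvature nabla x e`_y e`_z) lm.
rewrite (endo_trace_basis f eB) -sumrMnl.
transitivity (\sum_(x < n) \sum_(m < n) (Gam y z m * Gam x m x - Gam x z m * Gam y m x
                - c x y m * Gam m z x *+ 2)).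
  by apply: eq_bigr => x _; rewrite -coordn_curvature // coordn_ord.
transitivity (\sum_(m < n) Gam y z m * (\sum_(x < n) Gam x m x)
   - \sum_(x < n) \sum_(m < n) Gam x z m * (Gam m y x + c y m x *+ 2)
   + \sum_(x < n) \sum_(m < n) c y x m *+ 2 * Gam m z x).
  under [in RHS]eq_bigr => m _ do rewrite mulr_sumr.
  rewrite [in RHS]exchange_big /= -sumrB -big_split; apply: eq_bigr => x _ /=.
  rewrite -sumrB -big_split; apply: eq_bigr => m _ /=.
  by rewrite -(christoffel_skew x y m) (sconst_antisym e x y); ring.
rewrite big1 ?sub0r => [|m _]; last by rewrite sum_christoffel0 ?mulr0.
rewrite [X in _ + X]exchange_big addrC -opprB -sumrB [in RHS]exchange_big /=; congr (- _).
apply: eq_bigr => x _; rewrite -sumrB; apply: eq_bigr => m _ /=.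
ring.
Qed.

End Curvature.

(** * Ricci-flatness of arrow-breaking metrics *)

Section ArrowBreaking.
Variables (F : fieldType) (n : nat) (c : nat -> nat -> nat -> F) (s : nat -> nat) (g : nat -> F).
Hypothesis s_lt : forall i, (i < n)%N -> (s i < n)%N.
Hypothesis s_invol : forall i, (i < n)%N -> s (s i) = i.
Hypothesis g_neq0 : forall i, (i < n)%N -> g i != 0.
Hypothesis g_inv : forall i, (i < n)%N -> g (s i) = g i.
Hypothesis c_antisym : forall i j k, c i j k = - c j i k.
Hypothesis c_sorted : forall i j k, c i j k != 0 -> (i < k)%N /\ (j < k)%N.
Hypothesis breakl : forall i j k l, c i j k != 0 -> c (s i) (s j) l = 0.
Hypothesis breakr : forall a b i k, c a i k != 0 -> c b (s i) (s k) = 0.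

Lemma sum_swap_invol (f : nat -> nat -> F) :
  \sum_(i < n) \sum_(k < n) f (s k) (s i) = \sum_(i < n) \sum_(k < n) f i k.
Proof.
rewrite exchange_big /= (big_invol (fun i => \sum_(k < n) f i (s k)) s_lt s_invol).
by apply: eq_bigr => i _; rewrite (big_invol (f i) s_lt s_invol).
Qed.

Lemma arrow_breaking_sum y z : (y < n)%N -> (z < n)%N ->
  \sum_(i < n) \sum_(k < n) christoffel c s g i y k * christoffel c s g k z i = 0.
Proof.
move=> yn zn.
(* The products collected in [f] need not vanish; they cancel against their images
   under (i, k) |-> (s k, s i), all the others being zero. *)
pose f i k := c i y k * c k (s i) (s z) * g z / g i + c i (s k) (s y) * g y * c k z i / g k.
rewrite -[RHS](subrr (\sum_(i < n) \sum_(k < n) f i k)) -{1}sum_swap_invol -sumrB.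
apply: eq_bigr => i _; rewrite -sumrB; apply: eq_bigr => k _.
have [ni nk] := (ltn_ord i, ltn_ord k).
have p0 a b (P : b = 0 \/ a = 0) : a * b = 0 :> F by case: P => ->; rewrite ?mulr0 ?mul0r.
(* Let A be the bracket and B, C the two adjoint terms of each symbol. AA and CC vanish because
   arrows increase indices, AC, CA and BB because [s] is arrow-breaking; AB and BA make up [f i k],
   BC and CB make up [f (s k) (s i)]. *)
have sorted0 a a' : c a i k * c a' k i = 0.
  apply: p0; case: (eqVneq (c a i k) 0) => [|/c_sorted[_ ik]]; first by right.
  by left; apply/eqP/negPn/negP => /c_sorted[_ /(ltn_trans ik)]; rewrite ltnn.
have sorted0' a a' : c a (s k) (s i) * c a' (s i) (s k) = 0.
  apply: p0; case: (eqVneq (c a (s k) (s i)) 0) => [|/c_sorted[_ ik]]; first by right.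
  by left; apply/eqP/negPn/negP => /c_sorted[_ /(ltn_trans ik)]; rewrite ltnn.
have AC : c i y k * c z (s i) (s k) = 0.
  apply: p0; case: (eqVneq (c i y k) 0) => [|nz]; [by right | left].
  by apply: (@breakr y); rewrite c_antisym oppr_eq0.
have CA : c y (s k) (s i) * c k z i = 0.
  apply: p0; case: (eqVneq (c y (s k) (s i)) 0) => [|nz]; [by right | left].
  by rewrite c_antisym -(s_invol ni) -(s_invol nk) (breakr z nz) oppr0.
have BB : c i (s k) (s y) * c k (s i) (s z) = 0.
  apply: p0; case: (eqVneq (c i (s k) (s y)) 0) => [|nz]; [by right | left].
  by rewrite c_antisym -{1}(s_invol nk) (breakl _ nz) oppr0.
have AA : c i y k * c k z i = 0.
  by rewrite c_antisym (c_antisym k) mulrNN sorted0.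
rewrite /f !s_invol // !g_inv // (c_antisym (s k) y) (c_antisym (s i) k).
rewrite (c_antisym (s k) i) (c_antisym (s i) z) /christoffel.
have [gi gk] := (g_neq0 ni, g_neq0 nk).
transitivity (c i y k * c k z i - (c i y k * c z (s i) (s k)) * g k / g i
  + (c i (s k) (s y) * c k (s i) (s z)) * g y * g z / (g k * g i)
  - (c y (s k) (s i) * c k z i) * g i / g k
  + (c y (s k) (s i) * c z (s i) (s k))
  + (c y (s k) (s i) * c k (s i) (s z) * g z / g k + c i (s k) (s y) * g y * c z (s i) (s k) / g i)
  - (c i y k * c k (s i) (s z) * g z / g i + c i (s k) (s y) * g y * c k z i / g k)).
  by field; rewrite gi gk.
by rewrite AA AC BB CA sorted0' !mul0r !(subr0, addr0, add0r); field; rewrite gi gk.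
Qed.

End ArrowBreaking.

Local Close Scope ring_scope.

(** * Symbolic curvature *)

(* Contrary to [has] and [all], these do not evaluate their second branch under
   call-by-value. *)
Fixpoint lazy_has A (P : A -> bool) (r : seq A) : bool :=
  if r is x :: r' then if P x then true else lazy_has P r' else false.

Fixpoint lazy_all A (P : A -> bool) (r : seq A) : bool :=
  if r is x :: r' then if P x then lazy_all P r' else false else true.

Lemma lazy_hasE A (P : A -> bool) r : lazy_has P r = has P r.
Proof. by elim: r => //= x r ->; case: (P x). Qed.

Lemma lazy_allE A (P : A -> bool) r : lazy_all P r = all P r.
Proof. by elim: r => //= x r ->; case: (P x). Qed.

(* The variable (i, j) with i < j stands for the nonzero structure constant of
   [e_i, e_j], and (i, i) for a free coefficient of the metric. A [term] is a
   Laurent monomial: its sign (true for -1), numerator and denominator. A [vec] is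
   a sum of terms, each multiplying the basis vector of the given index. *)
Definition var : Type := (nat * nat)%type.
Definition term : Type := (bool * (seq var * seq var))%type.
Definition vec : Type := seq (nat * term).

Definition term_mul (t u : term) : term :=
  (t.1 (+) u.1, (t.2.1 ++ u.2.1, t.2.2 ++ u.2.2)).
Definition term_inv (t : term) : term := (t.1, (t.2.2, t.2.1)).
Definition term_opp (t : term) : term := (~~ t.1, t.2).
Definition vec_opp (p : vec) : vec := [seq (q.1, term_opp q.2) | q <- p].
Definition vec_bind (p : vec) (f : nat -> vec) : vec :=
  flatten [seq [seq (q.1, term_mul r.2 q.2) | q <- f r.1] | r <- p].
Definition vec_coef (k : nat) (p : vec) : seq term := [seq q.2 | q <- p & q.1 == k].

Fixpoint lazy_perm (p q : seq var) : bool :=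
  if p is v :: p' then if v \in q then lazy_perm p' (rem v q) else false
  else nilp q.
(** Equality of Laurent monomials up to sign, by cross-multiplication, so that fractions need not be
    reduced. *)
Definition term_sim (t u : term) : bool :=
  lazy_perm (t.2.1 ++ u.2.2) (u.2.1 ++ t.2.2).
Fixpoint insert_term (t : term) (p : seq term) : seq term :=
  if p is u :: p' then
    if t.1 == u.1 then u :: insert_term t p'
    else if term_sim t u then p' else u :: insert_term t p'
  else [:: t].
Definition cancel_terms (p : seq term) : seq term := foldr insert_term [::] p.
(** The terms left after cancellation, at least one, are copies of one signed monomial: the sum is a
    positive multiple of it, nonzero in characteristic 0. *)
Definition single_monomial (p : seq term) : bool :=
  if cancel_terms p is t :: p' then
    lazy_all (fun u => if t.1 == u.1 then term_sim t u else false) p'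
  else false.
(** Counting numerator and denominator together gives the parity of the exponent of [v]. *)
Definition parity (v : var) (t : term) : bool :=
  odd (count_mem v (t.2.1 ++ t.2.2)).

Local Open Scope ring_scope.

(** * Evaluation of symbolic sums at nonzero values of the variables *)

Section Evaluation.
Variables (F : numFieldType) (env : var -> F).
Hypothesis env_neq0 : forall v, env v != 0.

Definition eval_term (t : term) : F :=
  (-1) ^+ t.1 * (\prod_(v <- t.2.1) env v / \prod_(v <- t.2.2) env v).
Definition eval_sum (p : seq term) : F := \sum_(t <- p) eval_term t.
Definition eval_vec (k : nat) (p : vec) : F := \sum_(q <- p | q.1 == k) eval_term q.2.

Lemma prod_env_neq0 (p : seq var) : \prod_(v <- p) env v != 0.
Proof. by rewrite prodf_seq_neq0; apply/allP => v _ /=; apply: env_neq0. Qed.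

Lemma eval_term_neq0 t : eval_term t != 0.
Proof. by rewrite /eval_term !mulf_neq0 ?invr_eq0 ?signr_eq0 ?prod_env_neq0. Qed.

Lemma eval_term_mul t u : eval_term (term_mul t u) = eval_term t * eval_term u.
Proof. by rewrite /eval_term /= !big_cat signr_addb /= invfM; ring. Qed.

Lemma eval_term_inv t : eval_term (term_inv t) = (eval_term t)^-1.
Proof. by rewrite /eval_term /= !invfM invrK invr_sign [_ / _]mulrC. Qed.

Lemma eval_term_opp t : eval_term (term_opp t) = - eval_term t.
Proof. by rewrite /eval_term /= signrN mulNr. Qed.

Lemma eval_sum_cat p q : eval_sum (p ++ q) = eval_sum p + eval_sum q.
Proof. exact: big_cat. Qed.

Lemma eval_sum_mul p q : eval_sum [seq term_mul t u | t <- p, u <- q] = eval_sum p * eval_sum q.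
Proof.
elim: p => [|t p IH] /=; first by rewrite /eval_sum !big_nil mul0r.
rewrite eval_sum_cat IH /eval_sum big_cons mulrDl; congr (_ + _).
by rewrite big_map mulr_sumr; apply: eq_bigr => u _; rewrite eval_term_mul.
Qed.

Lemma eval_sum_coef k p : eval_sum (vec_coef k p) = eval_vec k p.
Proof. by rewrite /eval_sum big_map big_filter. Qed.

Lemma eval_vec_cat k p q : eval_vec k (p ++ q) = eval_vec k p + eval_vec k q.
Proof. exact: big_cat. Qed.

Lemma eval_vec_opp k p : eval_vec k (vec_opp p) = - eval_vec k p.
Proof. by rewrite /eval_vec big_map -sumrN; apply: eq_bigr => q _; rewrite eval_term_opp. Qed.

(** [vec_bind p f] is the image of [p] under the linear map sending e_m to [f m]. *)
Lemma eval_vec_bind n k p f : all (fun q => q.1 < n)%N p ->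
  eval_vec k (vec_bind p f) = \sum_(m < n) eval_vec m p * eval_vec k (f m).
Proof.
elim: p => [|q p IH] /=.
  by rewrite /eval_vec /vec_bind big_nil big1 // => m _; rewrite big_nil mul0r.
move=> /andP[qn pn]; rewrite /vec_bind /= eval_vec_cat -/(vec_bind p f) IH //.
rewrite [RHS](eq_bigr (fun m : 'I_n => (if q.1 == m then eval_term q.2 else 0) * eval_vec k (f m)
  + eval_vec m p * eval_vec k (f m))) => [|m _].
  rewrite big_split /=; congr (_ + _).
  rewrite (bigD1 (Ordinal qn)) //= eqxx big1 ?addr0 => [|m].
    rewrite /eval_vec big_map mulr_sumr.
    by apply: eq_bigr => r _; rewrite eval_term_mul.
  by rewrite -(inj_eq val_inj) eq_sym /= => /negPf->; rewrite mul0r.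
by rewrite {1}/eval_vec big_cons; case: eqP => _; rewrite ?mul0r ?add0r // mulrDl.
Qed.

Lemma lazy_perm_prod p q :
  lazy_perm p q -> \prod_(v <- p) env v = \prod_(v <- q) env v.
Proof.
elim: p q => [|v p IH] q /=; first by move/nilP->.
by case: ifP => // vq /IH E; rewrite big_cons E (big_rem v vq).
Qed.

Lemma term_sim_eval t u : term_sim t u ->
  (-1) ^+ t.1 * eval_term t = (-1) ^+ u.1 * eval_term u.
Proof.
move/lazy_perm_prod; rewrite !big_cat /= /eval_term !mulrA -!expr2 !sqrr_sign !mul1r => E.
by apply/eqP; rewrite eqr_div ?prod_env_neq0 // E.
Qed.

Lemma eval_sum_insert t p : eval_sum (insert_term t p) = eval_term t + eval_sum p.
Proof.
elim: p => [|u p IH] /=; first by rewrite /eval_sum big_seq1 big_nil addr0.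
have skip : eval_sum (u :: insert_term t p) = eval_term t + eval_sum (u :: p).
  by rewrite {1}/eval_sum big_cons -/(eval_sum _) IH /eval_sum big_cons addrCA.
case: ifP => // neq; case: ifP => // /term_sim_eval.
rewrite /eval_sum big_cons addrA; case: t.1 u.1 neq => [] [] // _.
  by rewrite expr0 expr1 mul1r mulN1r => <-; rewrite addrN add0r.
by rewrite expr0 expr1 mul1r mulN1r => ->; rewrite addNr add0r.
Qed.

Lemma eval_sum_cancel p : eval_sum (cancel_terms p) = eval_sum p.
Proof.
by elim: p => //= t p IH; rewrite eval_sum_insert IH /eval_sum big_cons.
Qed.

Lemma eval_sum_cancel_nil p : nilp (cancel_terms p) -> eval_sum p = 0.
Proof. by rewrite -eval_sum_cancel => /nilP->; rewrite /eval_sum big_nil. Qed.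

Lemma single_monomial_neq0 p : single_monomial p -> eval_sum p != 0.
Proof.
rewrite -eval_sum_cancel /single_monomial; case: (cancel_terms p) => // t p' same.
suff -> : eval_sum (t :: p') = eval_term t *+ (size p').+1 by rewrite mulrn_eq0 eval_term_neq0.
rewrite /eval_sum big_cons mulrS; congr (_ + _).
elim: p' same => [|u p' IH] /=; first by rewrite big_nil.
case: eqP => // tu; case: ifP => // /term_sim_eval tsimE /IH E.
have sg : (-1) ^+ u.1 != 0 :> F by rewrite signr_eq0.
by rewrite big_cons mulrS E; move: tsimE; rewrite tu => /(mulfI sg)->.
Qed.

End Evaluation.

Section Flip.
Variables (F : numFieldType) (env env' : var -> F) (v : var).
Hypothesis env_neq0 : forall w, env w != 0.
Hypothesis env'E : forall w, env' w = if w == v then - env w else env w.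

Lemma eval_term_flip t : eval_term env' t = (-1) ^+ parity v t * eval_term env t.
Proof.
have prodE p : \prod_(w <- p) env' w = (-1) ^+ count_mem v p * \prod_(w <- p) env w.
  elim: p => [|w p IH]; rewrite ?big_nil ?mulr1 // !big_cons IH env'E /= exprD.
  by case: (w == v); rewrite ?expr1 ?expr0; ring.
rewrite /eval_term !prodE /parity count_cat signr_odd exprD invfM -exprVn invrN1; ring.
Qed.

(** With O and E the parts odd and even in [v], the two values are E + O and E - O; both vanish only
    if O = E = 0. *)
Lemma single_monomial_flip p :
  single_monomial (filter (parity v) p) || single_monomial (filter (predC (parity v)) p) ->
  eval_sum env p != 0 \/ eval_sum env' p != 0.
Proof.
pose O := eval_sum env (filter (parity v) p).
pose E := eval_sum env (filter (predC (parity v)) p).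
have splitp : eval_sum env p = O + E.
  by rewrite /O /E /eval_sum !big_filter [LHS](bigID (parity v)).
have splitp' : eval_sum env' p = E - O.
  rewrite /O /E /eval_sum !big_filter [LHS](bigID (parity v)) /= addrC -sumrN.
  by congr (_ + _); apply: eq_bigr => t; rewrite eval_term_flip;
    [move/negPf-> | move->]; rewrite ?mul1r ?mulN1r.
move=> OE; apply/orP; apply: contraTT OE.
rewrite negb_or !negbK splitp splitp' subr_eq0 => /andP[OpE /eqP EO].
move: OpE; rewrite EO -mulr2n mulrn_eq0 /= => /eqP O0.
rewrite negb_or; apply/andP; split; apply/negP => /(single_monomial_neq0 env_neq0).
  by rewrite -/O O0 eqxx.
by rewrite -/E EO O0 eqxx.
Qed.

End Flip.

Local Close Scope ring_scope.

Definition lookup (T : seq (seq (option nat))) (x y : nat) : option nat :=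
  nth None (nth [::] T x) y.

(* [T] maps x, y to the k with [e_x, e_y] proportional to e_k, and [U] maps x, k to
   the y with [e_x, e_y] proportional to e_k. *)
Section Symbolic.
Variables (n : nat) (T U : seq (seq (option nat))) (s : seq nat) (gs : seq term).
Let sg x := nth 0 s x.
Let gt x := nth (false, ([::], [::])) gs x.

Definition sym_const (x y : nat) : term :=
  if x < y then (false, ([:: (x, y)], [::])) else (true, ([:: (y, x)], [::])).
Definition sym_bracket (x y : nat) : vec :=
  if lookup T x y is Some k then [:: (k, sym_const x y)] else [::].
(** Represents -ad_x^* y. There is at most one term, since at most one e_w has its bracket with e_x
    along e_(sg y). *)
Definition sym_adjoint (x y : nat) : vec :=
  if lookup U x (sg y) is Some w then
    [:: (sg w, term_opp (term_mul (sym_const x w) (term_mul (gt y) (term_inv (gt w)))))]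
  else [::].
Definition sym_christoffel (x y : nat) : vec :=
  sym_bracket x y ++ sym_adjoint x y ++ sym_adjoint y x.
(** Four times the curvature. The bracket part [r] occurs twice because it carries one doubled
    Christoffel symbol instead of two. *)
Definition sym_curvature (x y z : nat) : vec :=
  vec_bind (sym_christoffel y z) (sym_christoffel x) ++
  vec_opp (vec_bind (sym_christoffel x z) (sym_christoffel y)) ++
  let r := vec_opp (vec_bind (sym_bracket x y) (fun m => sym_christoffel m z)) in r ++ r.
(** The value is -4 times the Ricci tensor, by [ricciE]. *)
Definition sym_ricci (y z : nat) : seq term :=
  flatten [seq vec_coef i (vec_bind (sym_christoffel i y) (sym_christoffel^~ z))
          | i <- iota 0 n].
Definition sym_jacobi (i j k l : nat) : seq term :=
  vec_coef l (vec_bind (sym_bracket j k) (sym_bracket i)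
              ++ vec_bind (sym_bracket k i) (sym_bracket j)
              ++ vec_bind (sym_bracket i j) (sym_bracket k)).

(* [fs] lists the metric coefficients whose sign may be changed. *)
Definition nonflat (fs : seq nat) : bool :=
  lazy_has (fun q : nat * nat * nat => let: (x, y, z) := q in
    let r := sym_curvature x y z in
    lazy_has (fun w => let p := vec_coef w r in
      if nilp p then false else
      lazy_has (fun f =>
        if single_monomial (filter (parity (f, f)) p) then true
        else single_monomial (filter (predC (parity (f, f))) p)) fs) (iota 0 n))
    (flatten [seq [seq (x, y, z) | x <- iota 0 y, z <- iota 0 n] | y <- iota 0 n]).

Definition wf_metric : bool :=
  lazy_all (fun i => if sg i < n then if sg (sg i) == i then gt (sg i) == gt i
                     else false else false) (iota 0 n).

(* The Ricci tensor vanishes, if necessary after adding [p] times the component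
   along e_l of the Jacobi identity for e_i, e_j, e_k. *)
Definition sym_ricci_flat (p : seq term) (i j k l : nat) : bool :=
  lazy_all (fun y => lazy_all (fun z =>
    if nilp (cancel_terms (sym_ricci y z)) then true
    else nilp (cancel_terms
      (sym_ricci y z ++ [seq term_mul t u | t <- p, u <- sym_jacobi i j k l])))
    (iota 0 n)) (iota 0 n).

Local Open Scope ring_scope.

Section Sound.
Variables (F : numFieldType) (c : nat -> nat -> nat -> F).
Hypothesis c_antisym : forall i j k, c i j k = - c j i k.
Hypothesis c_out : forall i j k, [|| n <= i, n <= j | n <= k]%N -> c i j k = 0.
Hypothesis lookupT : forall x y k, (lookup T x y == Some k) = (c x y k != 0).
Hypothesis lookupU : forall x k y, (lookup U x k == Some y) = (c x y k != 0).
Hypothesis wf : wf_metric.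

Variables (d : nat -> F).
Hypothesis d_neq0 : forall i, d i != 0.

(** The default 1 for absent brackets keeps every variable nonzero, so that all monomials are
    invertible. *)
Definition env (v : var) : F :=
  if v.1 == v.2 then d v.1 else
  if lookup T v.1 v.2 is Some k then c v.1 v.2 k else 1.

Definition gval (i : nat) : F := eval_term env (gt i).

Lemma c_lt i j k : c i j k != 0 -> [/\ i < n, j < n & k < n]%N.
Proof.
move=> nz; have : ~~ [|| n <= i, n <= j | n <= k]%N.
  by apply/negP => /c_out c0; rewrite c0 eqxx in nz.
by rewrite !negb_or -!ltnNge => /and3P[].
Qed.

Lemma env_neq0 v : env v != 0.
Proof.
rewrite /env; case: ifP => _ //; case lk: lookup => [k|]; last exact: oner_neq0.
by rewrite -lookupT lk.
Qed.

Lemma c_diag i k : c i i k = 0.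
Proof.
apply/eqP; rewrite -[_ == 0](mulrn_eq0 _ 2) mulr2n {1}c_antisym.
by rewrite addNr.
Qed.

Lemma eval_sym_const x y k : c x y k != 0 -> eval_term env (sym_const x y) = c x y k.
Proof.
move=> nz; have nxy : x != y.
  by apply/eqP => xy; rewrite xy c_diag eqxx in nz.
rewrite /sym_const /eval_term; case: ifP => xy; rewrite /= big_seq1 big_nil divr1 /env /=.
  by move: nz; rewrite (negPf nxy) -lookupT expr0 mul1r => /eqP->.
have nz' : c y x k != 0 by rewrite c_antisym oppr_eq0.
move: (nz'); rewrite [y == x]eq_sym (negPf nxy) -lookupT expr1 mulN1r => /eqP->.
by rewrite -c_antisym.
Qed.

Lemma wf_sg i : (i < n)%N -> [/\ (sg i < n)%N, sg (sg i) = i & gval (sg i) = gval i].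
Proof.
move=> ni; have := wf; rewrite /wf_metric lazy_allE => /allP/(_ i).
rewrite mem_iota => /(_ ni).
by case: ifP => // ?; case: eqP => // ? /eqP E; rewrite /gval E.
Qed.

Lemma gval_neq0 i : gval i != 0.
Proof. exact/eval_term_neq0/env_neq0. Qed.

Lemma sym_bracketE k x y : eval_vec env k (sym_bracket x y) = c x y k.
Proof.
rewrite /sym_bracket; case lk: lookup => [k'|].
  rewrite /eval_vec big_cons big_nil /=; case: eqP => [<-|nk].
    by rewrite addr0 (@eval_sym_const _ _ k') // -lookupT lk.
  apply/esym/eqP/negPn; rewrite -lookupT lk; apply/negP => /eqP[kk].
  by rewrite kk in nk.
rewrite /eval_vec big_nil; apply/esym/eqP/negPn; by rewrite -lookupT lk.
Qed.

Lemma sym_adjointE k x y : (k < n)%N -> (y < n)%N ->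
  eval_vec env k (sym_adjoint x y) = - (c x (sg k) (sg y) * gval y / gval k).
Proof.
move=> nk ny; have [sk ssk gk] := wf_sg nk; rewrite /sym_adjoint.
case lk: lookup => [w|]; last first.
  rewrite /eval_vec big_nil.
  have /eqP -> : c x (sg k) (sg y) == 0 by apply/negPn; rewrite -lookupU lk.
  by rewrite !mul0r oppr0.
have nz : c x w (sg y) != 0 by rewrite -lookupU lk.
have [_ nw _] := c_lt nz; have [sw ssw gw] := wf_sg nw.
rewrite /eval_vec big_cons big_nil /=; case: eqP => [<-|nwk].
  rewrite addr0 eval_term_opp !eval_term_mul eval_term_inv (eval_sym_const nz) ssw.
  by rewrite -/(gval y) -/(gval w) gw mulrA.
have /eqP -> : c x (sg k) (sg y) == 0.
  apply/negPn; rewrite -lookupU lk; apply/negP => /eqP[wk].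
  by rewrite wk ssk in nwk.
by rewrite !mul0r oppr0.
Qed.

Lemma sym_christoffelE k x y : (k < n)%N -> (x < n)%N -> (y < n)%N ->
  eval_vec env k (sym_christoffel x y) = christoffel c sg gval x y k.
Proof.
move=> nk nx ny; rewrite !eval_vec_cat sym_bracketE !sym_adjointE // /christoffel.
by rewrite mulrDl opprD.
Qed.

Lemma sym_bracket_lt x y : all (fun q => q.1 < n)%N (sym_bracket x y).
Proof.
rewrite /sym_bracket; case lk: lookup => [k|] //=; rewrite andbT.
by have [] // : [/\ x < n, y < n & k < n]%N by apply: c_lt; rewrite -lookupT lk.
Qed.

Lemma sym_christoffel_lt x y : (x < n)%N -> (y < n)%N ->
  all (fun q => q.1 < n)%N (sym_christoffel x y).
Proof.
move=> nx ny; have adj u v : all (fun q => q.1 < n)%N (sym_adjoint u v).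
  rewrite /sym_adjoint; case lk: lookup => [w|] //=; rewrite andbT.
  have nz : c u w (sg v) != 0 by rewrite -lookupU lk.
  by have [_ /wf_sg[]] := c_lt nz.
by rewrite !all_cat sym_bracket_lt !adj.
Qed.

Local Notation Gam := (christoffel c sg gval).

Lemma sym_curvatureE w x y z : (w < n)%N -> (x < n)%N -> (y < n)%N -> (z < n)%N ->
  eval_vec env w (sym_curvature x y z) =
  \sum_(m < n) (Gam y z m * Gam x m w - Gam x z m * Gam y m w
                - c x y m * Gam m z w *+ 2).
Proof.
move=> nw nx ny nz; rewrite !eval_vec_cat !eval_vec_opp.
rewrite !(@eval_vec_bind _ _ n) ?sym_christoffel_lt ?sym_bracket_lt //.
rewrite !sumrB -!sumrN -!big_split.
apply: eq_bigr => m _; rewrite !sym_christoffelE // sym_bracketE /=.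
ring.
Qed.

Lemma sym_ricciE y z : (y < n)%N -> (z < n)%N ->
  eval_sum env (sym_ricci y z) = \sum_(i < n) \sum_(k < n) Gam i y k * Gam k z i.
Proof.
move=> ny nz; rewrite /sym_ricci.
rewrite -(big_mkord xpredT (fun i => \sum_(k < n) Gam i y k * Gam k z i)).
rewrite /index_iota subn0; have : all (gtn n) (iota 0 n).
  by apply/allP => i; rewrite mem_iota.
elim: (iota 0 n) => [|i r IH] /=; first by rewrite big_nil /eval_sum big_nil.
move=> /andP[ni nr]; rewrite eval_sum_cat IH // big_cons eval_sum_coef; congr (_ + _).
rewrite (@eval_vec_bind _ _ n) ?sym_christoffel_lt //; apply: eq_bigr => k _.
by rewrite !sym_christoffelE.
Qed.

Lemma sym_jacobiE i j k l :
  eval_sum env (sym_jacobi i j k l) =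
  \sum_(m < n) (c j k m * c i m l + c k i m * c j m l + c i j m * c k m l).
Proof.
rewrite eval_sum_coef !eval_vec_cat !(@eval_vec_bind _ _ n) ?sym_bracket_lt // -!big_split.
by apply: eq_bigr => m _ /=; rewrite !sym_bracketE addrA.
Qed.

End Sound.
End Symbolic.

Local Open Scope ring_scope.

(** * From symbolic checks to a metric *)

Section Certificate.
Variables (F : numFieldType) (V : lieAlgType F) (n : nat) (e : n.-tuple V).
Hypothesis eB : basis_of {:V} e.
Local Notation c := (sconst e).
Hypothesis c_sorted : forall i j k, c i j k != 0 -> (i < k)%N /\ (j < k)%N.

Variables (T U : seq (seq (option nat))) (s : seq nat) (gs : seq term) (fs : seq nat).
Hypothesis lookupT : forall x y k, (lookup T x y == Some k) = (c x y k != 0).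
Hypothesis lookupU : forall x k y, (lookup U x k == Some y) = (c x y k != 0).
Hypothesis wf : wf_metric n s gs.
Hypothesis ricci0 : forall d : nat -> F, (forall i, d i != 0) ->
  forall y z, (y < n)%N -> (z < n)%N ->
  \sum_(i < n) \sum_(k < n) christoffel c (nth 0%N s) (gval T gs c d) i y k
    * christoffel c (nth 0%N s) (gval T gs c d) k z i = 0.
Hypothesis notflat : nonflat n T U s gs fs.

(** The curvature test guarantees nonvanishing for one of two choices of signs only; as
    Ricci-flatness is assumed for all nonzero [d], the favourable choice can be taken. *)
Lemma certified_metric :
  exists g : {symmetric V}, [/\ nondegenerate g, ricci_flat g & ~ flat g].
Proof.
have anti := sconst_antisym e; have out := @sconst_out _ _ _ e.
have two : (2%:R : F) != 0 by rewrite pnatr_eq0.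
move: notflat; rewrite /nonflat lazy_hasE => /hasP[[[x y] z]].
move=> /flattenP[_ /mapP[y0 ny ->]] /allpairsP[[x0 z0] /= [nx nz [-> -> ->]]].
move: y0 x0 z0 ny nx nz => {x y z} y x z; rewrite !mem_iota /= !add0n => ny xy nz.
have nx := ltn_trans xy ny.
rewrite lazy_hasE => /hasP[w]; rewrite mem_iota /= add0n => nw.
case: ifP => // _; rewrite lazy_hasE => /hasP[f _]; set p := vec_coef _ _ => flip.
(* Unit coefficients, and the same with the sign of coefficient [f] reversed. *)
pose d1 (i : nat) : F := 1; pose d2 (i : nat) : F := if i == f then -1 else 1.
have d1nz i : d1 i != 0 by apply: oner_neq0.
have d2nz i : d2 i != 0 by rewrite /d2; case: ifP; rewrite ?oppr_eq0 oner_neq0.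
have {}flip : eval_sum (env T c d1) p != 0 \/ eval_sum (env T c d2) p != 0.
  apply: (single_monomial_flip (v := (f, f))); first exact: env_neq0.
    move=> [i j]; rewrite /env /d1 /d2 xpair_eqE /=; case: eqP => [->|].
      by rewrite andbb.
    by case: eqP => // -> /eqP; rewrite eq_sym => /negPf->.
  by move: flip; case: ifP.
have {flip} [d [dnz pnz]] : exists d, (forall i, d i != 0) /\ eval_sum (env T c d) p != 0.
  by case: flip => ?; [exists d1 | exists d2].
have wfP i (ni : (i < n)%N) := wf_sg T c wf d ni.
pose sg := nth 0%N s; pose g := gval T gs c d.
have sg_lt i : (i < n)%N -> (sg i < n)%N by move=> /wfP[].
have sg_invol i : (i < n)%N -> sg (sg i) = i by move=> /wfP[].
have g_inv i : (i < n)%N -> g (sg i) = g i by move=> /wfP[].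
have g_neq0 i : (i < n)%N -> g i != 0 by move=> _; apply: gval_neq0.
have [G [Gnd GE]] := smetric_exists eB sg_lt sg_invol g_neq0 g_inv.
exists G; split=> // [|[nabla [LC flatG]]].
  have [nabla LC] := levi_civita_exists two Gnd.
  exists nabla; split=> //; apply: (ricci_basis0 eB) => a b na nb.
  have /eqP := ricciE eB sg_lt sg_invol g_neq0 g_inv GE LC c_sorted na nb.
  by rewrite ricci0 // oppr0 mulrn_eq0 => /eqP.
move: pnz; rewrite eval_sum_coef (sym_curvatureE anti out lookupT lookupU wf d) //.
by rewrite -(coordn_curvature eB sg_lt sg_invol g_neq0 g_inv GE LC) // flatG coordn0 mul0rn eqxx.
Qed.

End Certificate.

Local Close Scope ring_scope.

(** * Enumeration of the diagrams *)

Definition arrow : Type := (nat * nat * nat)%type.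

Definition joins (i j x y : nat) : bool :=
  if i == x then j == y else if i == y then j == x else false.

Fixpoint target (D : seq arrow) (x y : nat) : option nat :=
  if D is (i, j, k) :: D' then
    if joins i j x y then Some k else target D' x y
  else None.
Fixpoint partner (D : seq arrow) (x l : nat) : option nat :=
  if D is (i, j, k) :: D' then
    if k == l then
      if i == x then Some j else if j == x then Some i else partner D' x l
    else partner D' x l
  else None.
Definition table (n : nat) (f : nat -> nat -> option nat) : seq (seq (option nat)) :=
  mkseq (fun x => mkseq (f x) n) n.

(** Distinct arrows that cannot coexist in a nice basis: same sources, or same target and a common
    source. *)
Definition conflict (t u : arrow) : bool :=
  let: (i, j, k) := t in let: (i', j', k') := u in
  if (if joins i j i' j' then true else
      if k == k' then [|| i == i', i == j', j == i' | j == j'] else false)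
  then t != u else false.

Definition has_arrow (D : seq arrow) (i j k : nat) : bool :=
  if (i, j, k) \in D then true else (j, i, k) \in D.
(* Whether [e_i, [e_j, e_k]] has a component along e_l. *)
Definition has_double (D : seq arrow) (i j k l : nat) : bool :=
  lazy_has (fun t : arrow => let: (a, b, m) := t in
    if joins a b j k then has_arrow D i m l else false) D.
(** A nonzero component along e_l of [e_i, [e_j, e_k]] must be compensated by one of the cyclic
    companions. If [i] is [j] or [k], the Jacobi identity holds trivially. *)
Definition jacobi_ok (D : seq arrow) (l : nat) : bool :=
  lazy_all (fun t : arrow => let: (p, q, r) := t in
    if r == l then
      lazy_all (fun u : arrow => let: (j, k, m) := u in
        let ok i := if i == j then true else if i == k then true else
          if has_double D j k i l then true else has_double D k i j l in
        if m == p then ok q else if m == q then ok p else true) D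
    else true) D.

(** Depth-first search deciding one arrow at a time; [inr l] tests the Jacobi identity along e_l,
    and a pruned branch counts as a success. *)
Fixpoint all_diagrams (P : seq arrow -> bool) (ts : seq (arrow + nat))
    (D : seq arrow) : bool :=
  match ts with
  | [::] => P D
  | inr l :: ts' => if jacobi_ok D l then all_diagrams P ts' D else true
  | inl t :: ts' =>
      if all_diagrams P ts' D then
        if lazy_has (conflict t) D then true else all_diagrams P ts' (t :: D)
      else false
  end.

Definition arrows_to (k : nat) : seq arrow :=
  [seq (i, j, k) | j <- iota 0 k, i <- iota 0 j].
(** Double brackets along e_k involve only arrows with targets up to k, so the Jacobi test can
    follow the arrows into k at once. *)
Definition steps (n : nat) : seq (arrow + nat) :=
  flatten [seq rcons (map inl (arrows_to k)) (inr k) | k <- iota 0 n].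
(** Checks that every arrow gets decided, and those with targets up to [l] before the Jacobi test at
    [l]; [D] collects the arrows already met. *)
Fixpoint complete (n : nat) (ts : seq (arrow + nat)) (D : seq arrow) : bool :=
  match ts with
  | [::] => all (fun k => all (mem D) (arrows_to k)) (iota 0 n)
  | inr l :: ts' =>
      all (fun k => all (mem D) (arrows_to k)) (iota 0 l.+1) && complete n ts' D
  | inl t :: ts' => complete n ts' (t :: D)
  end.

Section Diagrams.
Variables (n : nat) (S : nat -> nat -> nat -> bool).
Hypothesis arrow_sym : forall i j k, S i j k = S j i k.
Hypothesis S_sorted : forall i j k, S i j k -> (i < k)%N /\ (j < k)%N.
Hypothesis arrow_irr : forall i k, S i i k = false.
Hypothesis arrow_lt : forall i j k, S i j k -> [/\ i < n, j < n & k < n]%N.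
Hypothesis S_target : forall i j k k', S i j k -> S i j k' -> k = k'.
Hypothesis S_partner : forall i j j' k, S i j k -> S i j' k -> j = j'.
Hypothesis arrow_jacobi : forall i j k m l, i != j -> i != k -> S j k m -> S i m l ->
  exists m', S k i m' && S j m' l || S i j m' && S k m' l.

Definition in_S (t : arrow) : bool := let: (i, j, k) := t in S i j k.

Definition covers (D : seq arrow) (k : nat) :=
  forall i j, (i < j)%N -> S i j k -> (i, j, k) \in D.

Lemma joins_S i j x y k : joins i j x y -> S i j k = S x y k.
Proof.
rewrite /joins; case: eqP => [->|_]; first by move/eqP->.
by case: eqP => // -> /eqP->; rewrite arrow_sym.
Qed.

Lemma has_arrow_S D i j k : covers D k -> S i j k -> has_arrow D i j k.
Proof.
move=> cD Sijk; rewrite /has_arrow; case: (ltngtP i j) => [ij|ji|ij].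
- by rewrite cD.
- by case: ifP => // _; rewrite cD // arrow_sym.
- by rewrite ij arrow_irr in Sijk.
Qed.

Lemma has_double_S D i j k l m :
  (forall r, (r <= l)%N -> covers D r) -> S j k m -> S i m l -> has_double D i j k l.
Proof.
move=> cD Sjkm Siml; rewrite /has_double lazy_hasE; apply/hasP.
have [_ ml] := S_sorted Siml.
have arrow_i : has_arrow D i m l by apply: has_arrow_S => //; apply: cD.
case: (ltngtP j k) => [jk|kj|jk].
- exists (j, k, m); first exact: cD (ltnW ml) _ _ jk Sjkm.
  by rewrite /joins !eqxx.
- exists (k, j, m); first by apply: (cD _ (ltnW ml)) => //; rewrite arrow_sym.
  by rewrite /joins !eqxx; case: eqP => // kj'; rewrite kj' ltnn in kj.
- by rewrite jk arrow_irr in Sjkm.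
Qed.

Lemma jacobi_ok_S D l : all in_S D -> (forall r, (r <= l)%N -> covers D r) ->
  jacobi_ok D l.
Proof.
move=> /allP SD cD; rewrite /jacobi_ok lazy_allE; apply/allP => -[[p q] r] tD.
case: eqP => // rl; have {tD} Spql := SD _ tD; rewrite {}rl /= in Spql.
rewrite lazy_allE; apply/allP => -[[j k] m] uD; have {uD} Sjkm : S j k m := SD _ uD.
have ok i : S i m l -> (if i == j then true else if i == k then true else
          if has_double D j k i l then true else has_double D k i j l).
  move=> Siml; case: eqVneq => // ij; case: eqVneq => // ik.
  have [m' /orP[]/andP[S1 S2]] := arrow_jacobi ij ik Sjkm Siml.
    by rewrite (has_double_S cD S1 S2).
  by rewrite (has_double_S cD S1 S2); case: ifP.
case: eqP => [mp|_]; first by apply: ok; rewrite mp arrow_sym.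
by case: eqP => // mq; apply: ok; rewrite mq.
Qed.

(** Follows the branch prescribed by [S], which is never pruned. Invariant: [D] lies in [S] and
    contains every arrow of [S] listed in [pre], the arrows decided so far. *)
Lemma all_diagrams_S P ts pre D :
  all (fun t => if t is inl (i, j, k) then i < j else true)%N ts ->
  all (fun t : arrow => t.1.1 < t.1.2)%N D ->
  all_diagrams P ts D -> complete n ts pre -> all in_S D ->
  (forall t, t \in pre -> in_S t -> t \in D) ->
  exists D', [/\ P D', all in_S D' & forall k, covers D' k].
Proof.
have cov m (pre' D' : seq arrow) : all (fun k => all (mem pre') (arrows_to k)) (iota 0 m) ->
    (forall t, t \in pre' -> in_S t -> t \in D') ->
    forall k, (k < m)%N -> covers D' k.
  move=> /allP allk sub k km i j ij Sijk; apply: sub => //.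
  have /allP : all (mem pre') (arrows_to k) by apply: allk; rewrite mem_iota.
  apply; apply/allpairsPdep; exists j, i; rewrite !mem_iota /= !add0n; split=> //.
  by have [] := S_sorted Sijk.
elim: ts pre D => [|[[[i j] k]|l] ts IH] pre D /=.
- move=> _ _ PD comp SD sub; exists D; split=> // k i j ij Sijk.
  by have [_ _ kn] := arrow_lt Sijk; apply: (cov n pre D comp sub k kn).
- move=> /andP[ij ltts] ltD; case: ifP => // go_skip; case: ifP => [conf|_].
    move=> _ comp SD sub; apply: (IH _ _ ltts ltD go_skip comp SD) => t.
    rewrite inE => /predU1P[-> /= Sijk|]; last exact: sub.
    move: conf; rewrite lazy_hasE => /hasP[[[i' j'] k'] uD].
    have ij' := allP ltD _ uD; have /= Su := allP SD _ uD; rewrite /= in ij'.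
    rewrite /conflict; case: ifP => // shared.
    (* If the new arrow were in [S], uniqueness of targets and partners would make it equal to the
       one it conflicts with. *)
    suff -> : (i, j, k) = (i', j', k') by rewrite eqxx.
    move: shared; rewrite /joins; case: eqP => [ii|nii].
      subst i'; case: eqP => [jj _|njj]; first by subst j'; rewrite (S_target Sijk Su).
      by case: eqP => // kk _; subst k'; rewrite (S_partner Sijk Su).
    case: (i =P j') => [ij2|nij].
      subst j'; case: eqP => [ji|nji]; first by subst i'; have := ltn_trans ij ij'; rewrite ltnn.
      case: eqP => // kk _; subst k'; rewrite arrow_sym in Su.
      by have := S_partner Sijk Su; move=> ji; subst i'; case: nji.
    case: eqP => // kk; subst k'; rewrite /=.
    case: (j =P i') => [ji|nji] /=.
      subst i'; rewrite arrow_sym in Sijk; have ij'' := S_partner Sijk Su.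
      by case: nij.
    move=> /eqP jj; subst j'; rewrite arrow_sym in Sijk; rewrite arrow_sym in Su.
    by case: nii; apply: S_partner Sijk Su.
  move=> go_take comp SD sub.
  case Sijk: (S i j k).
    apply: (IH _ _ ltts _ go_take comp) => /=; rewrite ?ij ?Sijk //.
    move=> t; rewrite !inE => /predU1P[->|tp St]; first by rewrite eqxx.
    by rewrite (sub _ tp St) orbT.
  apply: (IH _ _ ltts ltD go_skip comp SD) => t.
  by rewrite inE => /predU1P[->|]; [rewrite /= Sijk | apply: sub].
- move=> ltts ltD; case: ifP => [_|nok] go_ts /andP[covl comp] SD sub.
    exact: (IH _ _ ltts ltD go_ts comp SD sub).
  suff : jacobi_ok D l by rewrite nok.
  by apply: jacobi_ok_S => // r rl; apply: (cov l.+1 pre).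
Qed.

End Diagrams.

(** * Candidate metrics on a diagram *)

Definition is_none (o : option nat) : bool := if o is None then true else false.

Definition breaking (T U : seq (seq (option nat))) (s : seq nat) (D : seq arrow) : bool :=
  lazy_all (fun t : arrow => let: (i, j, k) := t in
    if is_none (lookup T (nth 0 s i) (nth 0 s j)) then
      if is_none (lookup U (nth 0 s i) (nth 0 s k)) then
        is_none (lookup U (nth 0 s j) (nth 0 s k))
      else false
    else false) D.

(** A fixed point is recorded as (x, x), and [fuel] makes the recursion structural. The results are
    candidates, validated later by [wf_metric]. *)
Fixpoint matchings (fuel : nat) (r : seq nat) : seq (seq (nat * nat)) :=
  if fuel is m.+1 then
    if r is x :: r' then
      [seq (x, x) :: p | p <- matchings m r'] ++
      flatten [seq [seq (x, y) :: p | p <- matchings m (rem y r')] | y <- r']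
    else [:: [::]]
  else [:: [::]].
Definition involution (n : nat) (p : seq (nat * nat)) : seq nat :=
  mkseq (fun i => foldr (fun q a =>
    if q.1 == i then q.2 else if q.2 == i then q.1 else a) i p) n.
Definition involutions (n : nat) : seq (seq nat) :=
  [seq involution n p | p <- matchings n (iota 0 n)].

Definition coef_var (i : nat) : term := (false, ([:: (i, i)], [::])).
(** One free coefficient per orbit of the involution, named after its least element. *)
Definition coef_vars (s : seq nat) : seq term :=
  mkseq (fun i => coef_var (minn i (nth 0 s i))) (size s).

Definition breaking_metric (n : nat) (fs : seq nat) (D : seq arrow) (T U : seq (seq (option nat)))
    (s : seq nat) : bool :=
  if breaking T U s D then
    if wf_metric n s (coef_vars s) then nonflat n T U s (coef_vars s) fs else false
  else false.

Definition exception : Type := (seq arrow * seq nat * seq term * seq term)%type.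

Definition exceptional_metric (n : nat) (D : seq arrow) (T U : seq (seq (option nat)))
    (i j k l : nat) (r : exception) : bool :=
  let: (D', s, gs, p) := r in
  if D == D' then
    [&& wf_metric n s gs, sym_ricci_flat n T U s gs p i j k l & nonflat n T U s gs (iota 0 n)]
  else false.

(* Lists a diagram, an involution, the coefficients of the metric, and a multiplier of
   the Jacobi identity. The diagrams without arrow-breaking involution are those of the algebras
   (0,0,12,13), (0,0,12,13,14+23,25+34), (0,0,12,13,14,25+34,16+35) and
   (0,0,12,13,14+23,25+34,16+35), up to coefficients; a and b are their first two
   nodes, in either order. In each case a single component of the Ricci tensor is
   not identically zero, and the coefficients of the metric solve this binomial
   equation; in dimension 7 the solution relies on the Jacobi identity for
   e_a, e_b, e_4. *)
Definition exceptions (a b : nat) : seq exception :=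
  let ab A (x y : A) := if a < b then [:: x; y] else [:: y; x] in
  let c := sym_const in
  let m := term_mul (term_opp (c b 4)) (term_inv (coef_var a)) in
  let s7 := ab _ 4 6 ++ [:: 5; 3; a; 2; b] in
  let g7 := ab _ (coef_var a) (c b 4) ++ [:: c 2 4; coef_var 3; coef_var a; c 2 4; c b 4] in
  [:: ([:: (a, 2, 3); (0, 1, 2)],
       ab _ a 3 ++ [:: 2; b],
       ab _ (coef_var a) (c a b) ++ [:: c a 2; c a b], [::]);
      ([:: (b, 4, 5); (2, 3, 5); (a, 3, 4); (b, 2, 4); (a, 2, 3); (0, 1, 2)],
       ab _ 5 b ++ [:: 4; 3; 2; a],
       ab _ (c a b) (coef_var b) ++
         [:: term_opp (c b 4); coef_var 3; term_opp (c b 4); c a b], [::]);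
      ([:: (a, 5, 6); (2, 4, 6); (b, 4, 5); (2, 3, 5); (a, 3, 4); (a, 2, 3); (0, 1, 2)],
       s7, g7, nseq 4 m);
      ([:: (a, 5, 6); (2, 4, 6); (b, 4, 5); (2, 3, 5); (a, 3, 4); (b, 2, 4); (a, 2, 3);
           (0, 1, 2)],
       s7, g7, nseq 4 m)].

(* The variable (n, n) does not occur, so that [:: n] forbids any change of sign. *)
Definition settled (n : nat) (I : seq (seq nat)) (D : seq arrow) : bool :=
  if nilp D then true else
  if (if n <= 4 then size D == 1 else false) then true else
  let T := table n (target D) in
  let U := table n (partner D) in
  if lazy_has (breaking_metric n [:: n] D T U) I then true else
  if lazy_has (breaking_metric n (iota 0 n) D T U) I then true else
  if lazy_has (exceptional_metric n D T U 0 1 4 6) (exceptions 0 1) then true else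
  lazy_has (exceptional_metric n D T U 1 0 4 6) (exceptions 1 0).

(** * Agreement of the tables of a diagram with the structure constants *)

Section Tables.
Variables (n : nat) (S : nat -> nat -> nat -> bool) (D : seq arrow).
Hypothesis arrow_sym : forall i j k, S i j k = S j i k.
Hypothesis arrow_irr : forall i k, S i i k = false.
Hypothesis arrow_lt : forall i j k, S i j k -> [/\ i < n, j < n & k < n].
Hypothesis S_target : forall i j k k', S i j k -> S i j k' -> k = k'.
Hypothesis S_partner : forall i j j' k, S i j k -> S i j' k -> j = j'.
Hypothesis DS : all (in_S S) D.
Hypothesis covD : forall k, covers S D k.

Lemma arrow_memP i j k : S i j k -> ((i, j, k) \in D) || ((j, i, k) \in D).
Proof.
move=> Sijk; case: (ltngtP i j) => [ij|ji|ij]; first by rewrite covD.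
  by rewrite orbC covD // arrow_sym.
by rewrite ij arrow_irr in Sijk.
Qed.

Lemma target_sound x y k : target D x y = Some k -> S x y k.
Proof.
elim: D DS => // -[[i j] l] D' IH /= /andP[Sl /IH{}IH].
by case: ifP => // ij [<-]; rewrite -(joins_S arrow_sym l ij).
Qed.

Lemma target_complete i j k x y :
  (i, j, k) \in D -> joins i j x y -> target D x y != None.
Proof.
elim: D => // -[[i' j'] k'] D' IH /=; rewrite inE => /predU1P[[-> -> _] ->//|/IH{}IH ij].
by case: ifP => // _; apply: IH.
Qed.

Lemma targetE x y k : (target D x y == Some k) = S x y k.
Proof.
apply/eqP/idP => [|Sxyk]; first exact: target_sound.
have : target D x y != None.
  case/orP: (arrow_memP Sxyk) => /target_complete; apply; rewrite /joins !eqxx //.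
  by case: eqP => // ->; rewrite eqxx.
by case E: target => [k'|] // _; rewrite (S_target Sxyk (target_sound E)).
Qed.

Lemma partner_sound x k y : partner D x k = Some y -> S x y k.
Proof.
elim: D DS => // -[[i j] l] D' IH /= /andP[Sl /IH{}IH].
case: eqP => // lk; subst l; case: eqP => [<- [<-]|_] //.
by case: eqP => // <- [<-]; rewrite arrow_sym.
Qed.

Lemma partner_complete i j k x :
  (i, j, k) \in D -> (i == x) || (j == x) -> partner D x k != None.
Proof.
elim: D => // -[[i' j'] k'] D' IH /=; rewrite inE => /predU1P[[-> -> ->]|/IH{}IH ij].
  by rewrite eqxx; case: ifP => //= _ ->.
have {IH ij} tail := IH ij; case: ifP => // _.
by case: ifP => // _; case: ifP.
Qed.

Lemma partnerE x k y : (partner D x k == Some y) = S x y k.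
Proof.
apply/eqP/idP => [|Sxyk]; first exact: partner_sound.
have : partner D x k != None.
  by case/orP: (arrow_memP Sxyk) => /partner_complete; apply; rewrite eqxx ?orbT.
by case E: partner => [y'|] // _; rewrite (S_partner Sxyk (partner_sound E)).
Qed.

Lemma lookup_table (f : nat -> nat -> option nat) x y :
  (f x y != None -> x < n /\ y < n) -> lookup (table n f) x y = f x y.
Proof.
move=> fn; rewrite /lookup /table.
case: (ltnP x n) => xn; last first.
  rewrite [X in nth _ X]nth_default ?size_mkseq // nth_nil.
  by case: (f x y) fn => // k [] //; rewrite ltnNge xn.
rewrite nth_mkseq //; case: (ltnP y n) => yn; first by rewrite nth_mkseq.
rewrite nth_default ?size_mkseq //.
by case: (f x y) fn => // k [] // _; rewrite ltnNge yn.
Qed.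

Lemma lookup_target x y k : (lookup (table n (target D)) x y == Some k) = S x y k.
Proof.
rewrite lookup_table ?targetE //; case E: target => [k'|] // _.
by have [] := arrow_lt (target_sound E).
Qed.

Lemma lookup_partner x k y : (lookup (table n (partner D)) x k == Some y) = S x y k.
Proof.
rewrite lookup_table ?partnerE //; case E: partner => [y'|] // _.
by have [] := arrow_lt (partner_sound E).
Qed.

Lemma breaking_sound T U s :
  (forall x y k, (lookup T x y == Some k) = S x y k) ->
  (forall x k y, (lookup U x k == Some y) = S x y k) ->
  breaking T U s D ->
  (forall i j k l, S i j k -> S (nth 0 s i) (nth 0 s j) l = false) /\
  (forall a b i k, S a i k -> S b (nth 0 s i) (nth 0 s k) = false).
Proof.
move=> lookupT lookupU; rewrite /breaking lazy_allE => /allP br.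
have noneT x y l : is_none (lookup T x y) -> S x y l = false.
  by rewrite -lookupT; case: lookup.
have noneU x k y : is_none (lookup U x k) -> S x y k = false.
  by rewrite -lookupU; case: lookup.
split=> [i j k l|a b i k] /arrow_memP/orP[] /br.
- by case: ifP => // /noneT->.
- by case: ifP => // /noneT; rewrite arrow_sym => ->.
- by case: ifP => // _; case: ifP => // _ /noneU; rewrite arrow_sym => ->.
- by case: ifP => // _; case: ifP => // /noneU; rewrite arrow_sym => ->.
Qed.

End Tables.

(** The whole case analysis is a computation, which also covers the conditions on the order of
    [steps]. *)
Lemma all_settled n : n <= 7 ->
  all_diagrams (settled n (involutions n)) (steps n) [::] && complete n (steps n) [::]
  && all (fun t => if t is inl (i, j, k) then i < j else true) (steps n).
Proof.
have : lazy_all (fun n => all_diagrams (settled n (involutions n)) (steps n) [::]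
  && complete n (steps n) [::]
  && all (fun t => if t is inl (i, j, k) then i < j else true) (steps n)) (iota 0 8).
  by vm_compute.
by rewrite lazy_allE => /allP h n7; apply: h; rewrite mem_iota.
Qed.

Local Open Scope ring_scope.

(** * Sorted nice bases and Heisenberg algebras *)

Section NiceBasis.
Variables (F : fieldType) (V : lieAlgType F).

Section Constants.
Variables (n : nat) (e : n.-tuple V).
Hypothesis nice : nice_basis e.
Local Notation c := (sconst e).

Lemma nice_bracket i j k : c i j k != 0 ->
  exists2 a, a != 0 & [lie e`_i, e`_j] = a *: e`_k.
Proof.
have [eB br _] := nice => nz.
have : ~~ [|| n <= i, n <= j | n <= k]%N.
  by apply: contraNN nz => /sconst_out->.
rewrite !negb_or -!ltnNge => /and3P[ni nj nk].
have [h [a E]] := br (Ordinal ni) (Ordinal nj); rewrite /= in E.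
move: nz; rewrite /sconst E coordnZ coordn_basis //; case: (eqVneq k h) => [->|_];
  last by rewrite mulr0 eqxx.
by rewrite mulr1; exists a.
Qed.

Lemma nice_target i j k k' : c i j k != 0 -> c i j k' != 0 -> k = k'.
Proof.
have [eB _ _] := nice => nz; have [a _ E] := nice_bracket nz.
have nk : (k < n)%N.
  by rewrite ltnNge; apply: contraNN nz => nk; rewrite sconst_out // nk !orbT.
rewrite {1}/sconst E coordnZ coordn_basis //; case: (eqVneq k' k) => // _.
by rewrite mulr0 eqxx.
Qed.

(** By the second niceness condition, the form e_m |-> - [c i m k] is a multiple of one dual basis
    vector, so it is nonzero on at most one e_m. *)
Lemma nice_partner i j j' k : c i j k != 0 -> c i j' k != 0 -> j = j'.
Proof.
have [eB _ int] := nice => nz nz'.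
have out m : c i m k != 0 -> ~~ [|| n <= i, n <= m | n <= k]%N.
  by move=> nzm; apply: contraNN nzm => /sconst_out->.
have := out _ nz; have := out _ nz'.
rewrite !negb_or -!ltnNge => /and3P[ni nj' nk] /and3P[_ nj _].
have [h [a E]] := int (Ordinal ni) (Ordinal nk).
have cE m : (m < n)%N -> c i m k = - (a * (h == m :> nat)%:R).
  move=> nm; have := E e`_m; rewrite /interior /ce_diff /= -!coordn_ord coordn_basis //.
  by move=> <-; rewrite opprK.
move: nz nz'; rewrite !cE //.
case: (eqVneq (h : nat) j) => [<-|_]; last by rewrite mulr0 oppr0 eqxx.
by case: (eqVneq (h : nat) j') => [<-//|_]; rewrite mulr0 oppr0 eqxx.
Qed.

End Constants.

Lemma nice_basis_perm n (e e' : n.-tuple V) :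
  perm_eq e' e -> nice_basis e -> nice_basis e'.
Proof.
move=> /[dup] pe /tuple_permP[p e'E] [eB br int].
have e'p (i : 'I_n) : e'`_i = e`_(p i).
  by rewrite -!tnth_nth (_ : e' = [tuple tnth e (p i) | i < n]) ?tnth_mktuple //; apply: val_inj.
have e'B : basis_of {:V} e' by rewrite (perm_basis _ pe).
have coordp (k : 'I_n) v : coord e' k v = coord e (p k) v.
  rewrite {1}(coord_basis eB (memvf v)) (reindex_inj (@perm_inj _ p)) /=.
  under eq_bigr => i _ do rewrite -e'p.
  by rewrite coord_sum_free ?(basis_free e'B).
split=> // i j.
  have [k [a E]] := br (p i) (p j); exists (p^-1%g k), a.
  by rewrite !e'p permKV.
have [h [a E]] := int (p i) (p j); exists (p^-1%g h), a => y.
by rewrite coordp permKV -E e'p /interior /ce_diff coordp.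
Qed.

(** A nonzero bracket lies strictly deeper in the lower central series than both of its arguments,
    so sorting by depth orients all arrows upward. *)
Theorem sorted_nice_basis : lie_nilpotent V -> admits_nice_basis V ->
  exists2 e : (\dim {:V}).-tuple V, nice_basis e &
    forall i j k, sconst e i j k != 0 -> (i < k)%N /\ (j < k)%N.
Proof.
move=> [K LK0] [e0 nice0].
pose depth (x : V) := \max_(d < K | x \in lower_central V d) d.
pose e := [tuple of sort (relpre depth leq) e0].
have nice : nice_basis e by apply: nice_basis_perm nice0; rewrite /= perm_sort.
exists e => // i j k nz.
have [eB _ _] := nice.
have deep x y z a : z != 0 -> a != 0 -> [lie y, x] = a *: z -> (depth x < depth z)%N.
  move=> z0 a0 E.
  have K0 : (0 < K)%N.
    case: K LK0 {depth e nice eB nz} => // LK0; case/eqP: z0; apply/eqP.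
    by rewrite -memv0 -LK0 memvf.
  have [d xd dE] : {d : 'I_K | x \in lower_central V d & depth x = d}.
    by apply: eq_bigmax_cond; apply/card_gt0P; exists (Ordinal K0); apply: memvf.
  have zd : z \in lower_central V d.+1.
    have -> : z = a^-1 *: [lie y, x] by rewrite E scalerA mulVf ?scale1r.
    by rewrite memvZ // /lower_central iterS memv_lie_prodv ?memvf.
  (* The term of index [K] is zero, so it cannot contain the nonzero vector [z]. *)
  have dK : (d.+1 < K)%N.
    rewrite ltn_neqAle ltn_ord andbT; apply: contraNneq z0 => dK; move: zd.
    by rewrite dK LK0 memv0.
  by rewrite dE; apply: (leq_bigmax_cond (Ordinal dK)).
have out : ~~ [|| \dim {:V} <= i, \dim {:V} <= j | \dim {:V} <= k]%N.
  by apply: contraNN nz => /sconst_out->.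
move: out; rewrite !negb_or -!ltnNge => /and3P[ni nj nk].
have ek0 : e`_k != 0.
  apply/eqP => ek0; have := coordn_basis eB k nk.
  by rewrite ek0 coordn0 eqxx => /esym/eqP; rewrite oner_eq0.
have mono l m : (l < \dim {:V})%N -> (m < \dim {:V})%N ->
    (depth (e`_l)%R < depth (e`_m)%R)%N -> (l < m)%N.
  move=> nl nm; rewrite !ltnNge; apply: contraNN => ml.
  have srt : sorted (relpre depth leq) e by apply: sort_sorted => x y; apply: leq_total.
  apply: (sorted_leq_nth _ _ _ srt) => //; rewrite ?inE ?size_tuple //.
    by move=> x y z; apply: leq_trans.
  by move=> x /=.
have [a a0 E] := nice_bracket nice nz.
split; apply: mono => //; last exact: deep E.
apply: (deep _ e`_j _ (- a)) => //; first by rewrite oppr_eq0.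
by rewrite lie_bracketC E scaleNr.
Qed.

End NiceBasis.

(** A product of transpositions, correcting one value at a time. *)
Lemma perm_extend3 (T : finType) (a1 a2 a3 b1 b2 b3 : T) :
  a1 != a2 -> a1 != a3 -> a2 != a3 -> b1 != b2 -> b1 != b3 -> b2 != b3 ->
  exists p : {perm T}, [/\ p a1 = b1, p a2 = b2 & p a3 = b3].
Proof.
move=> a12 a13 a23 b12 b13 b23.
have [p [p1 p2]] : exists p : {perm T}, p a1 = b1 /\ p a2 = b2.
  pose s := tperm a1 b1; exists (s * tperm (s a2) b2)%g; rewrite !permM tpermL.
  by rewrite tpermL tpermD // ?[b2 == _]eq_sym // -{1}(tpermL a1 b1) (inj_eq perm_inj) eq_sym.
exists (p * tperm (p a3) b3)%g; rewrite !permM p1 p2 tpermL.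
by rewrite !tpermD // ?[b3 == _]eq_sym // -?{1}p1 -?{1}p2 (inj_eq perm_inj) eq_sym.
Qed.

Section Heisenberg.
Variables (F : fieldType) (V : lieAlgType F) (m : nat) (e : m.+3.-tuple V).
Hypothesis eB : basis_of {:V} e.
Variable a : F.
Hypothesis a0 : a != 0.
Hypothesis br01 : [lie e`_0, e`_1] = a *: e`_(m.+2).
Hypothesis br0 : forall i j : nat, [lie e`_i, e`_j] != 0 ->
  (i == 0)%N && (j == 1)%N || (i == 1)%N && (j == 0)%N.

Lemma heis_bracket x y :
  [lie x, y] = ((coordn e 0 x * coordn e 1 y - coordn e 1 x * coordn e 0 y) * a) *: e`_(m.+2).
Proof.
have br00 i j : ~~ ((i == 0)%N && (j == 1)%N || (i == 1)%N && (j == 0)%N) ->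
    [lie e`_i, e`_j] = 0.
  by move=> nij; apply/eqP; apply: contraNT nij; apply: br0.
have brl i : [lie e`_i, y] =
    (((i == 0)%:R * coordn e 1 y - (i == 1)%:R * coordn e 0 y) * a) *: e`_(m.+2).
  rewrite {1}(coordnE eB y) linear_sumr /= 2!big_ord_recl /= big1 ?addr0 => [|j _]; last first.
    by rewrite linearZr_LR /= br00 ?scaler0 // !andbF.
  rewrite /bump /= !linearZr_LR /=; case: i => [|[|i]] /=.
  - by rewrite lie_bracketxx br01 scaler0 add0r mul1r mul0r subr0 scalerA.
  - rewrite lie_bracketxx lie_bracketC br01 scaler0 addr0 mul0r mul1r sub0r.
    by rewrite scalerN scalerA mulNr scaleNr.
  - by rewrite !br00 // !scaler0 addr0 !mul0r subrr mul0r scale0r.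
rewrite {1}(coordnE eB x) linear_sumlz 2!big_ord_recl /= big1 ?addr0 => [|j _]; last first.
  by rewrite linearZl_LR /= brl /= !mul0r subrr mul0r scale0r scaler0.
rewrite /bump /= !linearZl_LR /= !brl /=.
by rewrite !mul1r !mul0r subr0 sub0r !scalerA -scalerDl; congr (_ *: _); ring.
Qed.

(** In [heisenberg] the bracket of the first two basis vectors is minus the last one, as de(x, y) =
    -e([x, y]); hence the factor -1/a on the last coordinate. *)
Let w (t : 'I_m.+3) : F := if t == ord_max then - a^-1 else 1.

Lemma heisenberg_iso : lie_isomorphic V (heisenberg F m).
Proof.
have w0 t : w t != 0 by rewrite /w; case: ifP => _; rewrite ?oppr_eq0 ?invr_eq0 ?oner_neq0.
pose f0 (v : V) : heisenberg F m := \row_t (w t * coord e t v).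
have f0_lin : linear f0.
  move=> b u v; apply/rowP => t; rewrite !mxE linearP /=; ring.
pose fm := GRing.isLinear.Build F V (heisenberg F m) *:%R f0 f0_lin.
pose f : {linear V -> heisenberg F m} := HB.pack f0 fm.
exists f; split.
  exists (fun r : 'rV_m.+3 => \sum_t ((w t)^-1 * r 0 t) *: e`_t) => [v|r].
    rewrite [RHS](coord_basis eB (memvf v)); apply: eq_bigr => t _.
    by rewrite mxE mulrA mulVf ?mul1r.
  apply/rowP => t; rewrite mxE coord_sum_free ?(basis_free eB) //.
  by rewrite mulrA mulfV ?mul1r.
move=> x y; apply/rowP => t; rewrite heis_bracket.
rewrite /lie_bracket /= /heisenberg_bracket /f0 !mxE linearZ /=.
rewrite -coordn_ord coordn_basis // /w.
have -> : (0 == ord_max :> 'I_m.+3) = false by [].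
have -> : (1 == ord_max :> 'I_m.+3) = false by rewrite -(inj_eq val_inj) /= modn_small.
rewrite -!coordn_ord !mul1r /= modn_small // -(inj_eq val_inj) /=.
case: eqP => _; last by rewrite !mulr0.
by rewrite !mulr1; field.
Qed.

End Heisenberg.

(** A reordering of the basis moves [i], [j] to the first two positions and [k] to the last. *)
Lemma one_bracket_heisenberg (F : fieldType) (V : lieAlgType F) (m : nat)
    (e : m.+3.-tuple V) (i j k : nat) : basis_of {:V} e ->
  i != j -> i != k -> j != k -> sconst e i j k != 0 ->
  (forall x y z, sconst e x y z != 0 -> [|| (x, y, z) == (i, j, k) | (x, y, z) == (j, i, k)]) ->
  lie_isomorphic V (heisenberg F m).
Proof.
move=> eB ij ik jk nz only.
have : ~~ [|| m.+3 <= i, m.+3 <= j | m.+3 <= k]%N.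
  by apply: contraNN nz => /sconst_out->.
rewrite !negb_or -!ltnNge => /and3P[ni nj nk].
pose o1 : 'I_m.+3 := lift ord0 ord0.
have [p [p0 p1 pm]] : exists p : {perm 'I_m.+3},
    [/\ p ord0 = Ordinal ni, p o1 = Ordinal nj & p ord_max = Ordinal nk].
  exact: perm_extend3.
pose e' := [tuple tnth e (p t) | t < m.+3].
have e'E (t : 'I_m.+3) : e'`_t = e`_(p t) by rewrite -!tnth_nth tnth_mktuple.
have pe : perm_eq e' e by apply/tuple_permP; exists p.
have e'B : basis_of {:V} e' by rewrite (perm_basis _ pe).
have brk (x y : nat) : [lie e`_x, e`_y] != 0 -> (x == i) && (y == j) || (x == j) && (y == i).
  move=> nzxy; suff [z nzz] : exists z, sconst e x y z != 0.
    by have := only _ _ _ nzz; rewrite !xpair_eqE => /orP[]/andP[->]; rewrite ?orbT.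
  have [z zn] : exists z : 'I_m.+3, sconst e x y z != 0; last by exists z.
  apply/existsP; apply: contraNT nzxy; rewrite negb_exists => /forallP all0.
  apply/eqP/(coordn_inj eB) => z nz'; rewrite coordn0; apply/eqP/negPn.
  exact: (all0 (Ordinal nz')).
have e0 : e'`_0 = e`_i by rewrite (e'E ord0) p0.
have e1 : e'`_1 = e`_j by rewrite (e'E o1) p1.
have em : e'`_(m.+2) = e`_k by rewrite (e'E ord_max) pm.
apply: (heisenberg_iso (e := e') e'B nz).
  rewrite e0 e1 em; apply: (coordn_inj eB) => z nz'; rewrite coordnZ coordn_basis //.
  case: (eqVneq z k) => [->|zk]; first by rewrite mulr1.
  rewrite mulr0; apply/eqP/negPn/negP => /only.
  by rewrite !xpair_eqE (negPf zk) !andbF.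
move=> x y nzxy.
have [nx|nx] := ltnP x m.+3; last by rewrite nth_default ?size_tuple // linear0l eqxx in nzxy.
have [ny|ny] := ltnP y m.+3; last first.
  by rewrite [X in [lie _, X]]nth_default ?size_tuple // linear0r eqxx in nzxy.
have inj u (t : 'I_m.+3) (nu : (u < m.+3)%N) : (p (Ordinal nu) == p t :> nat) = (u == t :> nat).
  by rewrite (inj_eq val_inj) (inj_eq perm_inj) -(inj_eq val_inj).
move: nzxy; rewrite (e'E (Ordinal nx)) (e'E (Ordinal ny)) => /brk.
have -> : i = p ord0 :> nat by rewrite p0.
have -> : j = p o1 :> nat by rewrite p1.
by rewrite !inj.
Qed.

(** * Metrics on a sorted nice basis in dimension at most 7 *)

Section NiceMetric.
Variables (F : numFieldType) (V : lieAlgType F) (n : nat) (e : n.-tuple V).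
Hypothesis nice : nice_basis e.
Local Notation c := (sconst e).
Hypothesis c_sorted : forall i j k, c i j k != 0 -> (i < k)%N /\ (j < k)%N.
Hypothesis n7 : (n <= 7)%N.

Let S (i j k : nat) : bool := c i j k != 0.

Lemma arrow_sym i j k : S i j k = S j i k.
Proof. by rewrite /S sconst_antisym oppr_eq0. Qed.

Lemma arrow_irr i k : S i i k = false.
Proof. by rewrite /S sconstii eqxx. Qed.

Lemma arrow_lt i j k : S i j k -> [/\ i < n, j < n & k < n]%N.
Proof.
move=> nz; have : ~~ [|| n <= i, n <= j | n <= k]%N.
  by apply: contraNN nz => /sconst_out->.
by rewrite !negb_or -!ltnNge => /and3P.
Qed.

Lemma sconst_jacobi i j k l :
  \sum_(m < n) (c j k m * c i m l + c k i m * c j m l + c i j m * c k m l) = 0.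
Proof.
have [eB _ _] := nice.
have step x y z : coordn e l [lie e`_x, [lie e`_y, e`_z]] = \sum_(m < n) c y z m * c x m l.
  rewrite {1}(coordnE eB [lie e`_y, e`_z]) linear_sumr.
  rewrite (coordn_sum e l (fun m => [lie e`_x, coordn e m [lie e`_y, e`_z] *: e`_m])).
  by apply: eq_bigr => m _; rewrite linearZr_LR coordnZ.
by rewrite !big_split /= -!step -!coordnD lie_jacobi coordn0.
Qed.

(** By uniqueness of targets, the first of the three sums in the Jacobi identity reduces to one
    nonzero term, so another sum has a nonzero term. *)
Lemma arrow_jacobi i j k m l : i != j -> i != k -> S j k m -> S i m l ->
  exists m', S k i m' && S j m' l || S i j m' && S k m' l.
Proof.
move=> ij ik Sjkm Siml; have [_ mn _] := arrow_lt Siml.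
have := sconst_jacobi i j k l; rewrite big_split big_split /=.
rewrite (bigD1 (Ordinal mn)) //= big1 ?addr0 => [|m' nm]; last first.
  case: (eqVneq (c j k m') 0) => [->|nz]; first by rewrite mul0r.
  by case/eqP: nm; apply: val_inj; rewrite /= (nice_target nice nz Sjkm).
have mul0 a b : ~~ ((a != 0) && (b != 0)) -> a * b = 0 :> F.
  by rewrite negb_and !negbK => /orP[]/eqP->; rewrite ?mul0r ?mulr0.
case: (pickP (fun m' : 'I_n => S k i m' && S j m' l || S i j m' && S k m' l)).
  by move=> m' Sm' _; exists m'.
move=> none; have {}none m' : ~~ (S k i m' && S j m' l) /\ ~~ (S i j m' && S k m' l).
  case: (ltnP m' n) => [nm'|nm'].
    by have := none (Ordinal nm'); move/negbT; rewrite negb_or => /andP.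
  by split; apply/negP => /andP[/arrow_lt[_ _]]; rewrite ltnNge nm'.
rewrite !big1 ?addr0 => [/eqP|m' _|m' _]; last by apply: mul0; case: (none m').
  by rewrite mulf_eq0 (negPf Sjkm) (negPf Siml).
by apply: mul0; case: (none m').
Qed.

(** The support of the structure constants is an enumerated diagram; the alternatives are the ways
    in which [settled] succeeds on it. *)
Lemma nice_metric :
  [\/ forall i j k, c i j k = 0,
      exists i j k, [/\ (n <= 4)%N, c i j k != 0, i != j &
        forall x y z, c x y z != 0 -> [|| (x, y, z) == (i, j, k) | (x, y, z) == (j, i, k)]]
    | exists g : {symmetric V}, [/\ nondegenerate g, ricci_flat g & ~ flat g]].
Proof.
have [eB _ _] := nice.
have [/andP[/andP[go comp] lt_steps]] := all_settled n7.
have [] := all_diagrams_S arrow_sym c_sorted arrow_irr arrow_lt (@nice_target _ _ _ _ nice)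
  (@nice_partner _ _ _ _ nice) arrow_jacobi lt_steps _ go comp => // D [ok DS cov].
have lookupT := lookup_target arrow_sym arrow_irr arrow_lt (@nice_target _ _ _ _ nice) DS cov.
have lookupU := lookup_partner arrow_sym arrow_irr arrow_lt (@nice_partner _ _ _ _ nice) DS cov.
have anti := sconst_antisym e; have out := @sconst_out _ _ _ e.
have break fs s : breaking_metric n fs D (table n (target D)) (table n (partner D)) s ->
    exists g : {symmetric V}, [/\ nondegenerate g, ricci_flat g & ~ flat g].
  rewrite /breaking_metric; case: ifP => // br; case: ifP => // wf notflat.
  have [breakl breakr] := breaking_sound arrow_sym arrow_irr cov lookupT lookupU br.
  apply: (certified_metric eB c_sorted lookupT lookupU wf _ notflat) => d d0 y z ny nz.
  have wfP i (ni : (i < n)%N) := wf_sg (table n (target D)) c wf d ni.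
  apply: arrow_breaking_sum => //.
  - by move=> i /wfP[].
  - by move=> i /wfP[].
  - by move=> i _; apply: gval_neq0.
  - by move=> i /wfP[].
  - by move=> i j k l nzc; apply/eqP/negPn; rewrite -/(S _ _ _) (breakl _ _ _ _ nzc).
  - by move=> a b i k nzc; apply/eqP/negPn; rewrite -/(S _ _ _) (breakr _ _ _ _ nzc).
have exc i j k l r : exceptional_metric n D (table n (target D)) (table n (partner D)) i j k l r ->
    exists g : {symmetric V}, [/\ nondegenerate g, ricci_flat g & ~ flat g].
  case: r => [[[D' s] gs] p]; rewrite /exceptional_metric.
  case: ifP => // _ /and3P[wf rf notflat].
  apply: (certified_metric eB c_sorted lookupT lookupU wf _ notflat) => d d0 y z ny nz.
  have envn0 := env_neq0 lookupT d0.
  rewrite -(sym_ricciE anti out lookupT lookupU wf d) //.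
  have := rf; rewrite /sym_ricci_flat lazy_allE => /allP/(_ y); rewrite mem_iota => /(_ ny).
  rewrite lazy_allE => /allP/(_ z); rewrite mem_iota => /(_ nz).
  case: ifP => [/(eval_sum_cancel_nil envn0)//|_ /(eval_sum_cancel_nil envn0)].
  rewrite eval_sum_cat => <-; rewrite -[LHS]addr0; congr (_ + _).
  (* The added multiple of the Jacobi identity evaluates to 0. *)
  have J0 : eval_sum (env (table n (target D)) c d) (sym_jacobi (table n (target D)) i j k l) = 0.
    by rewrite (sym_jacobiE anti out lookupT) sconst_jacobi.
  by rewrite eval_sum_mul J0 mulr0.
move: ok; rewrite /settled; case: ifP => [/nilP D0 _|_].
  apply: Or31 => i j k; apply/eqP/negPn/negP => nz.
  by have := arrow_memP arrow_sym arrow_irr cov nz; rewrite D0.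
case: ifP => [one _|_].
  apply: Or32; move: one; case: ifP => // n4.
  case: D DS cov {go lookupT lookupU break exc} => [|[[i j] k] []] //=.
  rewrite andbT => nz cov _; exists i, j, k; split=> //.
    by apply/eqP => ij; move: nz; rewrite ij arrow_irr.
  move=> x y z nzxyz; have := arrow_memP arrow_sym arrow_irr cov nzxyz; rewrite !inE.
  by rewrite !xpair_eqE => /orP[]/andP[/andP[-> ->] ->]; rewrite ?orbT.
rewrite !lazy_hasE; case: ifP => [/hasP[s _ /break ex] _|_]; first exact: Or33.
case: ifP => [/hasP[s _ /break ex] _|_]; first exact: Or33.
by case: ifP => [/hasP[r _ /exc ex] _|_ /hasP[r _ /exc ex]]; apply: Or33.
Qed.

End NiceMetric.

Unset Implicit Arguments.

Theorem corollary5p7 (R : realType) (V : lieAlgType R)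
  (dimV : (\dim {:V} <= 7)%N)
  (nonabelianV : ~ lie_abelian V)
  (nilpotentV : lie_nilpotent V)
  (niceV : admits_nice_basis V)
  (not_heis3 : ~ lie_isomorphic V (heisenberg R 0))
  (not_heis4 : ~ lie_isomorphic V (heisenberg R 1)) :
  exists g : {symmetric V}, [/\ nondegenerate g, ricci_flat g & ~ flat g].
Proof.
have [e nice srt] := sorted_nice_basis nilpotentV niceV.
have [eB _ _] := nice.
have [c0|[i [j [k [n4 nz ij only]]]]|//] := nice_metric nice srt dimV.
  case: nonabelianV => x y; rewrite (coordnE eB x) linear_sumlz big1 // => i _.
  rewrite (coordnE eB y) linear_sumr big1 // => j _.
  rewrite linearZl_LR linearZr_LR /=.
  suff -> : [lie e`_i, e`_j] = 0 by rewrite !scaler0.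
  by apply: (coordn_inj eB) => k _; rewrite coordn0 -/(sconst e i j k) c0.
have [ik jk] := srt _ _ _ nz.
have [_ _ nk] := arrow_lt nz.
(* The distinct indices [i] and [j] lie below [k], so [k] is at least 2. *)
have n3 : (2 < \dim {:V})%N.
  apply: leq_trans nk; rewrite ltnS ltnNge; apply/negP => k1; case/eqP: ij.
  have at0 l : (l < k)%N -> l = 0%N.
    by move=> lk; apply/eqP; rewrite -leqn0 -ltnS (leq_trans lk).
  by rewrite (at0 _ ik) (at0 _ jk).
have heis m : \dim {:V} = m.+3 -> lie_isomorphic V (heisenberg R m).
  (* The dimension is the length of the tuple [e], so it is generalised before [m.+3] replaces
     it. *)
  move: (\dim {:V}) e eB nz ij only {nice srt nk n3 n4 dimV} => n e eB nz ij only nm.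
  subst n; apply: (one_bracket_heisenberg eB ij _ _ nz only); apply/eqP => E.
    by rewrite E ltnn in ik.
  by rewrite E ltnn in jk.
move: n3 n4; rewrite leq_eqVlt => /orP[/eqP/esym/heis//|n3] n4.
by case: not_heis4; apply: heis; apply/eqP; rewrite eqn_leq n4.
Qed.
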